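(* Let $n \geq 1$. The natural surjection $B_{n+1} \rightarrow B_n$ has kernel $T_{n+1}v_{n}^2$.
   Context: Let $\Bbbk$ be a field of characteristic $0$; all algebras are unital $\Bbbk$-algebras and $\otimes=\otimes_\Bbbk$. The one-sided Witt algebra is the Lie algebra $W_{\geq -1}=\Bbbk[t]\partial$, $\partial=\frac{d}{dt}$, with bracket $[f\partial,g\partial]=(fg'-f'g)\partial$. It has basis $e_i=t^{i+1}\partial$ ($i\geq -1$). For $n\ge -1$ let $W_{\geq n}=\mathrm{span}_\Bbbk\{e_i\mid i\geq n\}$. For $n\geq 0$ let $\mathfrak g_n=W_{\geq 0}/W_{\geq n}$, with basis $v_i=e_i+W_{\geq n}$, $0\leq i\leq n-1$. $\mathrm U(\cdot)$ denotes the universal enveloping algebra. $A_1$ is the first Weyl algebra, generated by $t,\partial$ with $\partial t-t\partial=1$, and $T_n=A_1\otimes \mathrm U(\mathfrak g_n)$. The $n$th orbit homomorphism is the algebra homomorphism $\Psi_n:\mathrm U(W_{\geq -1})\to T_n$ determined by $\Psi_n(f\partial)=f\partial+\sum_{i=0}^{n-1}\frac{f^{(i+1)}}{(i+1)!}v_i$ for $f\in\Bbbk[t]$, and $B_n=\Psi_n(\mathrm U(W_{\geq -1}))$. The natural surjection $B_{n+1}\to B_n$ is the restriction of the quotient map $T_{n+1}\to T_n$ induced by $\mathfrak g_{n+1}\to\mathfrak g_n$ (so $v_n\mapsto 0$, $v_i\mapsto v_i$ for $i<n$); its composite with $\Psi_{n+1}$ is $\Psi_n$. *)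

(* Defs.v *)
From HB Require Import structures.
From mathcomp Require Import all_boot all_algebra generic_quotient ring_quotient.
From mathcomp Require Import ring zify.
From mathcomp Require Import boolp classical_sets.

Set Implicit Arguments.
Unset Strict Implicit.
Unset Printing Implicit Defensive.

Import GRing.Theory.
Local Open Scope ring_scope.
Local Open Scope quotient_scope.

(** * Unital associative algebras *)

(* MathComp's [algType] requires [1 != 0], which is not known in advance for an
   algebra given by generators and relations. We therefore use rings [A],
   possibly zero, with a unital ring morphism from [k] to the centre of [A],
   written [c%:U]; the scalar [c] acts on [A] as multiplication by [c%:U]. *)
HB.mixin Record isUAlg (k : fieldType) A of GRing.PzRing A := {
  ucst : k -> A;
  ucst_zmod : zmod_morphism ucst;
  ucst_monoid : monoid_morphism ucst;
  ucstC : forall (c : k) (x : A), ucst c * x = x * ucst c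
}.

#[short(type="ualgType")]
HB.structure Definition UAlg (k : fieldType) := {A of GRing.PzRing A & isUAlg k A}.

Notation "c %:U" := (ucst c) (at level 1, left associativity, format "c %:U")
  : ring_scope.

HB.instance Definition _ (k : fieldType) (A : ualgType k) :=
  GRing.isZmodMorphism.Build k A ucst ucst_zmod.
HB.instance Definition _ (k : fieldType) (A : ualgType k) :=
  GRing.isMonoidMorphism.Build k A ucst ucst_monoid.

Definition alg_hom (k : fieldType) (A B : ualgType k) (f : A -> B) : Prop :=
  [/\ zmod_morphism f, monoid_morphism f & forall c : k, f c%:U = c%:U].

(** * Algebras given by generators and relations *)

Inductive term (k : fieldType) (X : Type) : Type :=
| Gen of X
| Cst of k
| Add of term k X & term k X
| Mul of term k X & term k X.

Arguments Gen {k X}.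
Arguments Cst {k X}.
Arguments Add {k X}.
Arguments Mul {k X}.

Section Presentation.
Context (k : fieldType) (X : Type) (rels : term k X -> term k X -> Prop).

Inductive pcongr : term k X -> term k X -> Prop :=
| pc_rel s t : rels s t -> pcongr s t
| pc_refl s : pcongr s s
| pc_sym s t : pcongr s t -> pcongr t s
| pc_trans s t u : pcongr s t -> pcongr t u -> pcongr s u
| pc_add s s' t t' :
    pcongr s s' -> pcongr t t' -> pcongr (Add s t) (Add s' t')
| pc_mul s s' t t' :
    pcongr s s' -> pcongr t t' -> pcongr (Mul s t) (Mul s' t')
| pc_addA s t u : pcongr (Add s (Add t u)) (Add (Add s t) u)
| pc_addC s t : pcongr (Add s t) (Add t s)
| pc_add0 s : pcongr (Add (Cst 0) s) s
| pc_mul0 s : pcongr (Mul (Cst 0) s) (Cst 0)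
| pc_mulA s t u : pcongr (Mul s (Mul t u)) (Mul (Mul s t) u)
| pc_mul1 s : pcongr (Mul (Cst 1) s) s
| pc_mulDl s t u : pcongr (Mul (Add s t) u) (Add (Mul s u) (Mul t u))
| pc_mulDr s t u : pcongr (Mul s (Add t u)) (Add (Mul s t) (Mul s u))
| pc_cstD c d : pcongr (Cst (c + d)) (Add (Cst c) (Cst d))
| pc_cstM c d : pcongr (Cst (c * d)) (Mul (Cst c) (Cst d))
| pc_cstC c s : pcongr (Mul (Cst c) s) (Mul s (Cst c)).

Definition cterm : Type := {classic (term k X)}.

Definition pcongrb (s t : cterm) : bool := `[< pcongr s t >].

Lemma pcongrb_equiv : equiv_class_of pcongrb.
Proof.
split=> [s|s t|t s u]; first exact/asboolP/pc_refl.
- by apply/asboolP/asboolP; apply: pc_sym.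
- by move=> /asboolP st /asboolP tu; apply/asboolP/(pc_trans st tu).
Qed.

Canonical pcongr_equiv := EquivRelPack pcongrb_equiv.
Canonical pcongr_encModRel := defaultEncModRel pcongrb.

(* The algebra generated by [X] with the relations [s = t] for [rels s t]. *)
Definition presented : Type := {eq_quot pcongrb}.

HB.instance Definition _ := Choice.on presented.

Definition pcls (t : term k X) : presented := \pi_({eq_quot pcongrb}) t.
Definition prep (x : presented) : term k X :=
  @repr _ {eq_quot pcongrb} x.

Lemma prepK x : pcls (prep x) = x.
Proof. exact: reprK. Qed.

Lemma pclsP s t : pcls s = pcls t <-> pcongr s t.
Proof.
have E : (pcls s == pcls t) = pcongrb s t by exact: eqmodE.
by split => [/eqP|H]; [rewrite E => /asboolP | apply/eqP; rewrite E; apply/asboolP].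
Qed.

Lemma prep_cls t : pcongr (prep (pcls t)) t.
Proof. by apply/pclsP; rewrite prepK. Qed.

Definition padd x y := pcls (Add (prep x) (prep y)).
Definition pmul x y := pcls (Mul (prep x) (prep y)).
Definition pscale c x := pcls (Mul (Cst c) (prep x)).
Definition popp x := pscale (-1) x.

Lemma paddE s t : padd (pcls s) (pcls t) = pcls (Add s t).
Proof. by apply/pclsP; apply: pc_add; apply: prep_cls. Qed.
Lemma pmulE s t : pmul (pcls s) (pcls t) = pcls (Mul s t).
Proof. by apply/pclsP; apply: pc_mul; apply: prep_cls. Qed.
Lemma pscaleE c t : pscale c (pcls t) = pcls (Mul (Cst c) t).
Proof. by apply/pclsP; apply: pc_mul; [apply: pc_refl | apply: prep_cls]. Qed.

Lemma presentedW (P : presented -> Prop) : (forall t, P (pcls t)) -> forall x, P x.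
Proof. by move=> H x; rewrite -(prepK x). Qed.

Lemma paddA : associative padd.
Proof.
elim/presentedW=> s; elim/presentedW=> t; elim/presentedW=> u.
by rewrite !paddE; apply/pclsP; apply: pc_addA.
Qed.

Lemma paddC : commutative padd.
Proof.
elim/presentedW=> s; elim/presentedW=> t.
by rewrite !paddE; apply/pclsP; apply: pc_addC.
Qed.

Lemma padd0 : left_id (pcls (Cst 0)) padd.
Proof. by elim/presentedW=> s; rewrite !paddE; apply/pclsP; apply: pc_add0. Qed.

Lemma paddN : left_inverse (pcls (Cst 0)) popp padd.
Proof.
elim/presentedW=> s; rewrite /popp pscaleE paddE; apply/pclsP.
apply: (pc_trans (pc_add (pc_refl _) (pc_sym (pc_mul1 s)))).
apply: (pc_trans (pc_sym (pc_mulDl _ _ _))).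
apply: (pc_trans (pc_mul (pc_sym (pc_cstD _ _)) (pc_refl _))).
by rewrite addNr; apply: pc_mul0.
Qed.

HB.instance Definition _ :=
  GRing.isZmodule.Build presented paddA paddC padd0 paddN.

Lemma pmulA : associative pmul.
Proof.
elim/presentedW=> s; elim/presentedW=> t; elim/presentedW=> u.
by rewrite !pmulE; apply/pclsP; apply: pc_mulA.
Qed.

Lemma pmul1l : left_id (pcls (Cst 1)) pmul.
Proof. by elim/presentedW=> s; rewrite !pmulE; apply/pclsP; apply: pc_mul1. Qed.

Lemma pmul1r : right_id (pcls (Cst 1)) pmul.
Proof.
elim/presentedW=> s; rewrite !pmulE; apply/pclsP.
exact: (pc_trans (pc_sym (pc_cstC _ _)) (pc_mul1 _)).
Qed.

Lemma pmulDl : left_distributive pmul padd.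
Proof.
elim/presentedW=> s; elim/presentedW=> t; elim/presentedW=> u.
by rewrite !(paddE, pmulE); apply/pclsP; apply: pc_mulDl.
Qed.

Lemma pmulDr : right_distributive pmul padd.
Proof.
elim/presentedW=> s; elim/presentedW=> t; elim/presentedW=> u.
by rewrite !(paddE, pmulE); apply/pclsP; apply: pc_mulDr.
Qed.

HB.instance Definition _ := GRing.Zmodule_isPzRing.Build presented
  pmulA pmul1l pmul1r pmulDl pmulDr.

Definition pcst (c : k) : presented := pcls (Cst c).

Lemma pcst_zmod : zmod_morphism pcst.
Proof.
move=> a b; rewrite -[RHS]/(padd _ (popp _)) /popp /pcst pscaleE paddE.
apply/pclsP/(pc_trans (pc_cstD _ _))/pc_add; first exact: pc_refl.
by rewrite -(mulN1r b); apply: pc_cstM.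
Qed.

Lemma pcst_monoid : monoid_morphism pcst.
Proof. by split=> // a b; rewrite [RHS]pmulE; apply/pclsP; apply: pc_cstM. Qed.

Lemma pcstC c x : pcst c * x = x * pcst c.
Proof.
elim/presentedW: x => s; rewrite [LHS]pmulE [RHS]pmulE.
by apply/pclsP; apply: pc_cstC.
Qed.

HB.instance Definition _ := isUAlg.Build k presented pcst_zmod pcst_monoid pcstC.

Definition pgen (x : X) : presented := pcls (Gen x).

End Presentation.

Arguments pgen {k X rels}.

Fixpoint term_eval (k : fieldType) (X : Type) (A : ualgType k) (f : X -> A)
    (t : term k X) : A :=
  match t with
  | Gen x => f x
  | Cst c => c%:U
  | Add s u => term_eval f s + term_eval f u
  | Mul s u => term_eval f s * term_eval f u
  end.

Section UniversalProperty.
Context (k : fieldType) (X : Type) (rels : term k X -> term k X -> Prop).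
Context (A : ualgType k) (f : X -> A).

Definition satisfies : Prop :=
  forall s t, rels s t -> term_eval f s = term_eval f t.

Definition plift (_ : satisfies) (x : presented rels) : A :=
  term_eval f (prep x).

Hypothesis Hf : satisfies.

Lemma term_eval_congr s t : pcongr rels s t -> term_eval f s = term_eval f t.
Proof.
elim=> //=.
- by move=> ? ? ? _ -> _ ->.
- by move=> ? ? ? ? _ -> _ ->.
- by move=> ? ? ? ? _ -> _ ->.
- by move=> *; rewrite addrA.
- by move=> *; rewrite addrC.
- by move=> *; rewrite rmorph0 add0r.
- by move=> *; rewrite rmorph0 mul0r.
- by move=> *; rewrite mulrA.
- by move=> *; rewrite rmorph1 mul1r.
- by move=> *; rewrite mulrDl.
- by move=> *; rewrite mulrDr.
- by move=> *; rewrite rmorphD.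
- by move=> *; rewrite rmorphM.
- by move=> *; rewrite ucstC.
Qed.

Lemma pliftE t : plift Hf (pcls rels t) = term_eval f t.
Proof. exact/term_eval_congr/prep_cls. Qed.

Lemma plift_gen x : plift Hf (pgen x) = f x.
Proof. by rewrite pliftE. Qed.

Lemma plift_hom : alg_hom (plift Hf).
Proof.
split=> [||c]; last by rewrite [LHS]pliftE.
- elim/presentedW=> s; elim/presentedW=> t.
  rewrite -[X in plift _ X]/(padd _ (popp _)) /popp pscaleE paddE !pliftE /=.
  by rewrite rmorphN1 mulN1r.
- split; first by rewrite [LHS]pliftE /= rmorph1.
  elim/presentedW=> s; elim/presentedW=> t.
  by rewrite [_ * _ in LHS]pmulE !pliftE.
Qed.

End UniversalProperty.

Lemma alg_homD (k : fieldType) (A B : ualgType k) (f : A -> B) :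
  alg_hom f -> {morph f : x y / x + y}.
Proof.
move=> [fB _ _] x y.
have f0 : f 0 = 0 by rewrite -[X in f X](subrr (0 : A)) fB subrr.
have fN : f (- y) = - f y by rewrite -[X in f X]sub0r fB f0 sub0r.
by rewrite -{1}[y]opprK fB fN opprK.
Qed.

Lemma alg_hom_ext (k : fieldType) (X : Type)
    (rels : term k X -> term k X -> Prop) (A : ualgType k)
    (f g : presented rels -> A) :
  alg_hom f -> alg_hom g -> (forall x, f (pgen x) = g (pgen x)) -> f =1 g.
Proof.
move=> hf hg fg; case: (hf) => _ [_ fM] fc; case: (hg) => _ [_ gM] gc.
elim/presentedW; elim=> [x|c|s IHs t IHt|s IHs t IHt].
- exact: fg.
- by rewrite [LHS](fc c) [RHS](gc c).
- rewrite -paddE -[padd _ _]/(pcls rels s + pcls rels t).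
  by rewrite (alg_homD hf) (alg_homD hg) IHs IHt.
- by rewrite -pmulE -[pmul _ _]/(pcls rels s * pcls rels t) fM gM IHs IHt.
Qed.

(** * The first Weyl algebra *)

Section Weyl.
Context (k : fieldType).

(* The generator [false] is [t] and the generator [true] is the derivation. *)
Inductive weyl_rels : term k bool -> term k bool -> Prop :=
| weyl_rel : weyl_rels (Mul (Gen true) (Gen false))
                       (Add (Mul (Gen false) (Gen true)) (Cst 1)).

Definition weyl : Type := presented weyl_rels.
HB.instance Definition _ := UAlg.on weyl.

Definition wt : weyl := pgen false.
Definition wd : weyl := pgen true.

Definition wpoly (f : {poly k}) : weyl := \sum_(i < size f) (f`_i)%:U * wt ^+ i.

Lemma weyl_comm : wd * wt - wt * wd = 1.
Proof.
apply/eqP; rewrite subr_eq addrC; apply/eqP.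
by rewrite [LHS]pmulE [wt * wd]pmulE [RHS]paddE; apply/pclsP/pc_rel/weyl_rel.
Qed.

End Weyl.

(** * Tensor products of algebras *)

Section Tensor.
Context (k : fieldType) (A B : ualgType k).

Inductive tens_rels : term k (A * B) -> term k (A * B) -> Prop :=
| tens_Dl a a' b : tens_rels (Gen (a + a', b)) (Add (Gen (a, b)) (Gen (a', b)))
| tens_Dr a b b' : tens_rels (Gen (a, b + b')) (Add (Gen (a, b)) (Gen (a, b')))
| tens_Zl c a b : tens_rels (Gen (c%:U * a, b)) (Mul (Cst c) (Gen (a, b)))
| tens_Zr c a b : tens_rels (Gen (a, c%:U * b)) (Mul (Cst c) (Gen (a, b)))
| tens_1 : tens_rels (Gen (1, 1)) (Cst 1)
| tens_M a a' b b' :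
    tens_rels (Gen (a * a', b * b')) (Mul (Gen (a, b)) (Gen (a', b'))).

(* The tensor product of two algebras is presented by the symbols [a ⊗ b],
   which are bilinear and multiply componentwise. *)
Definition tensor : Type := presented tens_rels.
HB.instance Definition _ := UAlg.on tensor.

Definition tens (a : A) (b : B) : tensor := pgen (a, b).

Lemma tensDl a a' b : tens (a + a') b = tens a b + tens a' b.
Proof. by rewrite [RHS]paddE; apply/pclsP/pc_rel/tens_Dl. Qed.
Lemma tensDr a b b' : tens a (b + b') = tens a b + tens a b'.
Proof. by rewrite [RHS]paddE; apply/pclsP/pc_rel/tens_Dr. Qed.
Lemma tensZl c a b : tens (c%:U * a) b = c%:U * tens a b.
Proof. by rewrite [RHS]pmulE; apply/pclsP/pc_rel/tens_Zl. Qed.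
Lemma tensZr c a b : tens a (c%:U * b) = c%:U * tens a b.
Proof. by rewrite [RHS]pmulE; apply/pclsP/pc_rel/tens_Zr. Qed.
Lemma tens11 : tens 1 1 = 1.
Proof. by apply/pclsP/pc_rel/tens_1. Qed.
Lemma tensM a a' b b' : tens a b * tens a' b' = tens (a * a') (b * b').
Proof. by rewrite [LHS]pmulE; apply/pclsP/pc_sym/pc_rel/tens_M. Qed.

Lemma tens_is_additive_l b : zmod_morphism (tens^~ b).
Proof.
move=> x y; apply: (addIr (tens y b)).
by rewrite /= -tensDl !subrK.
Qed.
Lemma tens_is_additive_r a : zmod_morphism (tens a).
Proof.
move=> x y; apply: (addIr (tens a y)).
by rewrite -tensDr !subrK.
Qed.

Section Lift.
Context (C : ualgType k) (f : A -> B -> C).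

Record tens_bimorphism : Prop := {
  tbDl : forall a a' b, f (a + a') b = f a b + f a' b;
  tbDr : forall a b b', f a (b + b') = f a b + f a b';
  tbZl : forall c a b, f (c%:U * a) b = c%:U * f a b;
  tbZr : forall c a b, f a (c%:U * b) = c%:U * f a b;
  tb1 : f 1 1 = 1;
  tbM : forall a a' b b', f (a * a') (b * b') = f a b * f a' b'
}.

Hypothesis Hf : tens_bimorphism.

Lemma tens_satisfies : satisfies tens_rels (fun p => f p.1 p.2).
Proof.
case: Hf => hDl hDr hZl hZr h1 hM s t; case=> *; rewrite /= ?rmorph1 //.
Qed.

Definition tens_lift : tensor -> C := plift tens_satisfies.

Lemma tens_liftE a b : tens_lift (tens a b) = f a b.
Proof. exact: plift_gen. Qed.

Lemma tens_lift_hom : alg_hom tens_lift.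
Proof. exact: plift_hom. Qed.

End Lift.
End Tensor.

Section TensorMap.
Context (k : fieldType) (A B B' : ualgType k) (g : B -> B') (Hg : alg_hom g).

Lemma tens_mapr_bimorphism : tens_bimorphism (fun a b => tens a (g b) : tensor A B').
Proof.
have gD := alg_homD Hg; case: Hg => _ [g1 gM] gc; split=> *.
- by rewrite tensDl.
- by rewrite gD tensDr.
- by rewrite tensZl.
- by rewrite gM gc tensZr.
- by rewrite g1 tens11.
- by rewrite gM tensM.
Qed.

Definition tens_mapr : tensor A B -> tensor A B' := tens_lift tens_mapr_bimorphism.

End TensorMap.

(** * Lie algebras and enveloping algebras *)

HB.mixin Record isLie (k : fieldType) L of GRing.Lmodule k L := {
  lie : L -> L -> L;
  lie_linear_l : forall y, linear (lie^~ y);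
  lie_linear_r : forall x, linear (lie x);
  lie_alt : forall x, lie x x = 0;
  lie_jacobi : forall x y z,
    lie x (lie y z) + lie y (lie z x) + lie z (lie x y) = 0
}.

#[short(type="lieType")]
HB.structure Definition Lie (k : fieldType) := {L of GRing.Lmodule k L & isLie k L}.

Definition lie_hom (k : fieldType) (L M : lieType k) (f : L -> M) : Prop :=
  linear f /\ forall x y, f (lie x y) = lie (f x) (f y).

Section Enveloping.
Context (k : fieldType) (L : lieType k).

Inductive env_rels : term k L -> term k L -> Prop :=
| env_add x y : env_rels (Gen (x + y)) (Add (Gen x) (Gen y))
| env_scale c x : env_rels (Gen (c *: x)) (Mul (Cst c) (Gen x))
| env_lie x y : env_rels (Mul (Gen x) (Gen y))
                         (Add (Gen (lie x y)) (Mul (Gen y) (Gen x))).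

Definition env : Type := presented env_rels.
HB.instance Definition _ := UAlg.on env.

Definition env_in (x : L) : env := pgen x.

Lemma env_inD x y : env_in (x + y) = env_in x + env_in y.
Proof. by rewrite [RHS]paddE; apply/pclsP/pc_rel/env_add. Qed.
Lemma env_inZ c x : env_in (c *: x) = c%:U * env_in x.
Proof. by rewrite [RHS]pmulE; apply/pclsP/pc_rel/env_scale. Qed.
Lemma env_in_lie x y :
  env_in (lie x y) = env_in x * env_in y - env_in y * env_in x.
Proof.
apply/eqP; rewrite eq_sym subr_eq; apply/eqP.
by rewrite [LHS]pmulE [_ * _ in RHS]pmulE [RHS]paddE; apply/pclsP/pc_rel/env_lie.
Qed.

Section Lift.
Context (A : ualgType k) (f : L -> A).

Record lie_morphism : Prop := {
  lmD : forall x y, f (x + y) = f x + f y;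
  lmZ : forall c x, f (c *: x) = c%:U * f x;
  lmB : forall x y, f (lie x y) = f x * f y - f y * f x
}.

Hypothesis Hf : lie_morphism.

Lemma env_satisfies : satisfies env_rels f.
Proof.
by case: Hf => hD hZ hB s t; case=> *; rewrite /= ?hB ?subrK.
Qed.

Definition env_lift : env -> A := plift env_satisfies.

Lemma env_liftE x : env_lift (env_in x) = f x.
Proof. exact: plift_gen. Qed.

Lemma env_lift_hom : alg_hom env_lift.
Proof. exact: plift_hom. Qed.

End Lift.
End Enveloping.

Section EnvelopingMap.
Context (k : fieldType) (L M : lieType k) (f : L -> M) (Hf : lie_hom f).

Lemma env_map_morphism : lie_morphism (fun x => env_in (f x)).
Proof.
case: Hf => fl fb; split=> [x y|c x|x y].
- by rewrite -[x]scale1r fl !scale1r env_inD.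
- have f0 : f 0 = 0.
    by rewrite -[X in f X](addNr (0 : L)) -scaleN1r fl scaleN1r addNr.
  by rewrite -[_ *: x]addr0 fl f0 addr0 env_inZ.
- by rewrite fb env_in_lie.
Qed.

Definition env_map : env L -> env M := env_lift env_map_morphism.

Lemma env_map_hom : alg_hom env_map.
Proof. exact: env_lift_hom. Qed.

End EnvelopingMap.

(** * Quotient Lie algebras *)

Record lieIdeal (k : fieldType) (L : lieType k) := LieIdeal {
  lideal_pred : {pred L};
  lideal_submod : submod_closed lideal_pred;
  lideal_lie : forall x y, y \in lideal_pred -> lie x y \in lideal_pred
}.

HB.instance Definition _ (k : fieldType) (L : lieType k) (I : lieIdeal L) :=
  GRing.isSubmodClosed.Build k L (lideal_pred I) (lideal_submod I).

Section LieQuotient.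
Context (k : fieldType) (L : lieType k) (I : lieIdeal L).
Local Notation J := (lideal_pred I).

Definition lquot : Type := Quotient.quot J.
HB.instance Definition _ := GRing.Zmodule.on lquot.

Definition lpi (x : L) : lquot := \pi_(Quotient.quot J) x.
Definition lrep (x : lquot) : L := @repr _ (Quotient.quot J) x.

Lemma lrepK x : lpi (lrep x) = x.
Proof. exact: reprK. Qed.

Lemma lpiP x y : lpi x = lpi y <-> x - y \in J.
Proof. by rewrite (Quotient.idealrBE J); split=> /eqP. Qed.

Lemma lrep_pi x : lrep (lpi x) - x \in J.
Proof. by apply/lpiP; rewrite lrepK. Qed.

Lemma lpiD x y : lpi (x + y) = lpi x + lpi y.
Proof. exact: Quotient.pi_add. Qed.

Lemma lie_lideal_r (x y : L) : y \in J -> lie x y \in J.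
Proof. exact: lideal_lie. Qed.

Lemma lie_lin_r (x : L) : linear (lie x). Proof. exact: lie_linear_r. Qed.
Lemma lie_lin_l (y : L) : linear (lie^~ y). Proof. exact: lie_linear_l. Qed.

HB.instance Definition _ (x : L) := GRing.isLinear.Build k L L _ (lie x) (lie_lin_r x).

Lemma lieDl (x y z : L) : lie (x + y) z = lie x z + lie y z.
Proof. by rewrite -[x]scale1r [LHS](lie_lin_l z) !scale1r. Qed.

Lemma lieC (x y : L) : lie x y = - lie y x.
Proof.
apply/eqP; rewrite -addr_eq0; apply/eqP.
move: (lie_alt (x + y)); rewrite lieDl !raddfD /= !lie_alt add0r addr0.
by [].
Qed.

Lemma lie_lideal_l (x y : L) : x \in J -> lie x y \in J.
Proof. by move=> xJ; rewrite lieC rpredN lie_lideal_r. Qed.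

Lemma lieBl (x y z : L) : lie (x - y) z = lie x z - lie y z.
Proof. by rewrite lieDl [lie (- y) z]lieC raddfN opprK -lieC. Qed.

Definition lscale (c : k) (x : lquot) : lquot := lpi (c *: lrep x).
Definition llie (x y : lquot) : lquot := lpi (lie (lrep x) (lrep y)).

Lemma lscaleE c x : lscale c (lpi x) = lpi (c *: x).
Proof. by apply/lpiP; rewrite -scalerBr; apply: rpredZ; apply: lrep_pi. Qed.

Lemma llieE x y : llie (lpi x) (lpi y) = lpi (lie x y).
Proof.
apply/lpiP; rewrite -(subrKA (lie x (lrep (lpi y)))) -lieBl -[X in _ + X]raddfB.
by apply: rpredD; [apply: lie_lideal_l|apply: lie_lideal_r]; apply: lrep_pi.
Qed.

Lemma lquotW (P : lquot -> Prop) : (forall x, P (lpi x)) -> forall x, P x.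
Proof. by move=> H x; rewrite -(lrepK x). Qed.

Lemma lscaleA a b x : lscale a (lscale b x) = lscale (a * b) x.
Proof. by elim/lquotW: x => x; rewrite !lscaleE scalerA. Qed.
Lemma lscale1 : left_id 1 lscale.
Proof. by elim/lquotW=> x; rewrite lscaleE scale1r. Qed.
Lemma lscaleDr : right_distributive lscale +%R.
Proof.
by move=> a; elim/lquotW=> x; elim/lquotW=> y; rewrite -lpiD !lscaleE -lpiD scalerDr.
Qed.
Lemma lscaleDl x : {morph lscale^~ x : a b / a + b}.
Proof. by elim/lquotW: x => x a b; rewrite !lscaleE -lpiD scalerDl. Qed.

HB.instance Definition _ := GRing.Zmodule_isLmodule.Build k lquot
  lscaleA lscale1 lscaleDr lscaleDl.

Lemma lpi_linear : linear lpi.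
Proof. by move=> c x y; rewrite lpiD; congr (_ + _); rewrite -lscaleE. Qed.

HB.instance Definition _ := GRing.isLinear.Build k L lquot _ lpi lpi_linear.

Lemma lpi0 x : x \in J -> lpi x = 0.
Proof. by move=> xJ; rewrite -(raddf0 lpi); apply/lpiP; rewrite subr0. Qed.

Lemma llie_linear_r x : linear (llie x).
Proof.
elim/lquotW: x => x c; elim/lquotW=> y; elim/lquotW=> z.
by rewrite -lpi_linear !llieE -lpi_linear lie_lin_r.
Qed.

Lemma llie_alt x : llie x x = 0.
Proof. by elim/lquotW: x => x; rewrite llieE lie_alt raddf0. Qed.

Lemma llie_linear_l y : linear (llie^~ y).
Proof.
elim/lquotW: y => y c; elim/lquotW=> x; elim/lquotW=> z.
by rewrite -lpi_linear !llieE -lpi_linear; congr lpi; apply: lie_lin_l.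
Qed.

Lemma llie_jacobi x y z :
  llie x (llie y z) + llie y (llie z x) + llie z (llie x y) = 0.
Proof.
elim/lquotW: x => x; elim/lquotW: y => y; elim/lquotW: z => z.
by rewrite !llieE -!lpiD lie_jacobi raddf0.
Qed.

HB.instance Definition _ :=
  isLie.Build k lquot llie_linear_l llie_linear_r llie_alt llie_jacobi.

Lemma lpi_lie x y : lie (lpi x) (lpi y) = lpi (lie x y).
Proof. exact: llieE. Qed.

End LieQuotient.

(** * The one-sided Witt algebra and its quotients *)

Section Witt.
Context (k : fieldType).

(* The polynomial [f] stands for the derivation [f ∂]. *)
Definition witt : Type := {poly k}.
HB.instance Definition _ := GRing.Lmodule.on witt.

Definition witt_lie (f g : {poly k}) : {poly k} := f * g^`() - f^`() * g.

Lemma witt_lie_linear_r f : linear (witt_lie f : witt -> witt).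
Proof.
move=> c g h; rewrite /witt_lie derivD derivZ !mulrDr -!scalerAr scalerBr.
by rewrite opprD addrACA.
Qed.

Lemma witt_lieC f g : witt_lie f g = - witt_lie g f.
Proof. by rewrite /witt_lie opprB mulrC [f^`() * g]mulrC mulrC. Qed.

Lemma witt_lie_linear_l g : linear (witt_lie^~ g : witt -> witt).
Proof.
move=> c f h; rewrite witt_lieC [LHS](congr1 -%R (witt_lie_linear_r g c f h)).
by rewrite opprD -scalerN -!witt_lieC.
Qed.

Lemma witt_lie_alt f : witt_lie f f = 0.
Proof. by rewrite /witt_lie mulrC subrr. Qed.

Lemma witt_lie_jacobi f g h :
  witt_lie f (witt_lie g h) + witt_lie g (witt_lie h f) +
  witt_lie h (witt_lie f g) = 0.
Proof. by rewrite /witt_lie !(derivB, derivM); ring. Qed.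

HB.instance Definition _ := isLie.Build k witt witt_lie_linear_l
  witt_lie_linear_r witt_lie_alt witt_lie_jacobi.

(* The derivations [t^(n+1) f ∂], which span the same space as the
   [e_i = t^(i+1) ∂] with [i >= n] (see [wittgeP]). *)
Definition wittge (n : nat) : {pred witt} :=
  fun f => ('X^(n.+1) : {poly k}) %| (f : {poly k}).

Definition witt_e (i : nat) : witt := 'X^(i.+1).

Lemma wittgeP n (f : witt) :
  reflect (exists m (c : 'I_m -> k), f = \sum_(i < m) c i *: witt_e (n + i))
          (f \in wittge n).
Proof.
apply: (iffP idP) => [/dvdpP[q ->]|[m [c ->]]].
  exists (size q), (fun i => q`_i).
  rewrite -[q in LHS]coefK poly_def mulr_suml; apply: eq_bigr => i _.
  by rewrite -scalerAl -exprD addnS addnC.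
rewrite unfold_in; apply: (big_ind (fun p : {poly k} => 'X^(n.+1) %| p)).
- exact: dvdp0.
- by move=> p q; apply: dvdp_add.
- by move=> i _; rewrite -mul_polyC dvdp_mull // dvdp_exp2l // ltnS leq_addr.
Qed.

Lemma wittge_submod n : submod_closed (wittge n).
Proof.
split=> [|c f g]; rewrite !unfold_in; first exact: dvdp0.
move=> hf hg; apply: dvdp_add => //.
by rewrite -mul_polyC dvdp_mull.
Qed.

HB.instance Definition _ (n : nat) :=
  GRing.isSubmodClosed.Build k witt (wittge n) (wittge_submod n).

Lemma wittge_lie m n f g :
  f \in wittge m -> g \in wittge n -> lie f g \in wittge (m + n).
Proof.
rewrite !unfold_in => /dvdpP[p ->] /dvdpP[q ->].
rewrite /lie /= /witt_lie !derivM !derivXn.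
apply/dvdpP; exists (p * q^`() * 'X - p^`() * q * 'X
  + p * q *+ n.+1 - p * q *+ m.+1).
by rewrite /= !exprS !exprD; ring.
Qed.

Record witt0 : Type := Witt0 { witt0_val : witt; witt0P : witt0_val \in wittge 0 }.
HB.instance Definition _ := [isSub for witt0_val].
HB.instance Definition _ := [Choice of witt0 by <:].
HB.instance Definition _ := [SubChoice_isSubLmodule of witt0 by <:].

Definition witt0_lie (x y : witt0) : witt0 :=
  Witt0 (wittge_lie (witt0P x) (witt0P y)).

Lemma witt0_lie_linear_r x : linear (witt0_lie x).
Proof. by move=> c y z; apply: val_inj; apply: witt_lie_linear_r. Qed.

Lemma witt0_lie_linear_l y : linear (witt0_lie^~ y).
Proof. by move=> c x z; apply: val_inj; apply: witt_lie_linear_l. Qed.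

Lemma witt0_lie_alt x : witt0_lie x x = 0.
Proof. by apply: val_inj; apply: witt_lie_alt. Qed.

Lemma witt0_lie_jacobi x y z :
  witt0_lie x (witt0_lie y z) + witt0_lie y (witt0_lie z x) +
  witt0_lie z (witt0_lie x y) = 0.
Proof. by apply: val_inj; apply: witt_lie_jacobi. Qed.

HB.instance Definition _ := isLie.Build k witt0 witt0_lie_linear_l
  witt0_lie_linear_r witt0_lie_alt witt0_lie_jacobi.

Definition witt0ge (n : nat) : {pred witt0} := fun x => witt0_val x \in wittge n.

Lemma witt0ge_submod n : submod_closed (witt0ge n).
Proof.
split=> [|c x y]; first exact: (wittge_submod n).1.
exact: (wittge_submod n).2.
Qed.

Lemma witt0ge_lie n (x y : witt0) : y \in witt0ge n -> lie x y \in witt0ge n.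
Proof. exact: (wittge_lie (witt0P x)). Qed.

Definition wittge_ideal (n : nat) : lieIdeal witt0 :=
  LieIdeal (witt0ge_submod n) (@witt0ge_lie n).

Definition gLie (n : nat) : Type := lquot (wittge_ideal n).
HB.instance Definition _ n := Lie.on (gLie n).

Fact witt0_e_subproof i : witt_e i \in wittge 0.
Proof. by rewrite unfold_in dvdp_exp2l. Qed.

Definition witt0_e (i : nat) : witt0 := Witt0 (witt0_e_subproof i).

(* The class of [e_i]; it vanishes for [i >= n]. *)
Definition gv (n i : nat) : gLie n := lpi (wittge_ideal n) (witt0_e i).

Lemma gv_eq0 n i : (n <= i)%N -> gv n i = 0.
Proof.
by move=> ni; apply: lpi0; rewrite 2!unfold_in /= dvdp_exp2l.
Qed.

Lemma gv_lie n i j : lie (gv n i) (gv n j) = (j%:R - i%:R : k) *: gv n (i + j).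
Proof.
transitivity (lpi (wittge_ideal n) ((j%:R - i%:R : k) *: witt0_e (i + j))); last first.
  exact/esym/lscaleE.
rewrite [LHS]lpi_lie; congr lpi; apply: val_inj => /=.
rewrite -[LHS]/(witt_lie (witt_e i) (witt_e j)) /witt_lie /witt_e !derivXn /= -[RHS]mul_polyC polyCB !polyC_natr.
by rewrite !exprS exprD; ring.
Qed.

Definition gLie_proj (n : nat) (x : gLie n.+1) : gLie n :=
  lpi (wittge_ideal n) (lrep x).

Lemma gLie_projE n x :
  gLie_proj (lpi (wittge_ideal n.+1) x) = lpi (wittge_ideal n) x.
Proof.
apply/lpiP; have := lrep_pi (wittge_ideal n.+1) x.
by rewrite !unfold_in /=; apply: dvdp_trans; rewrite dvdp_exp2l.
Qed.

Lemma gLie_proj_hom n : lie_hom (@gLie_proj n).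
Proof.
split=> [c|]; elim/lquotW=> x; elim/lquotW=> y.
  by rewrite -linearP !gLie_projE linearP.
by rewrite [lie _ _ in LHS]lpi_lie !gLie_projE [RHS]lpi_lie.
Qed.

Lemma gLie_proj_v n i : gLie_proj (gv n.+1 i) = gv n i.
Proof. exact: gLie_projE. Qed.

(** * The orbit homomorphisms *)

Definition Talg (n : nat) : Type := tensor (weyl k) (env (gLie n)).
HB.instance Definition _ n := UAlg.on (Talg n).

Definition Talg_proj (n : nat) : Talg n.+1 -> Talg n :=
  tens_mapr (env_map_hom (gLie_proj_hom n)).

(* The element [1 ⊗ v_i] of [T_n]. *)
Definition Talg_v (n i : nat) : Talg n := tens 1 (env_in (gv n i)).

(* [f^`N(i.+1)] is the derivative of order [i.+1] divided by [(i.+1)`!]. *)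
Definition Psi_gen (n : nat) (f : witt) : Talg n :=
  tens (wpoly f * wd k) 1
  + \sum_(i < n) tens (wpoly f^`N(i.+1)) (env_in (gv n i)).

Lemma nderivn_fact : [pchar k] =i pred0 -> forall (f : {poly k}) i,
  f^`N(i) = (i`!%:R)^-1 *: f^`(i).
Proof.
move=> k0 f i; rewrite nderivn_def -scaler_nat scalerA mulVf ?scale1r //.
by rewrite (pcharf0P _).1 // -lt0n fact_gt0.
Qed.

Lemma wpoly_wide (f : {poly k}) n : (size f <= n)%N ->
  wpoly f = \sum_(i < n) (f`_i)%:U * wt k ^+ i.
Proof.
move=> fn; rewrite /wpoly (big_ord_widen _ (fun i => (f`_i)%:U * wt k ^+ i) fn).
rewrite big_mkcond; apply: eq_bigr => i _; case: ltnP => // h.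
by rewrite nth_default // rmorph0 mul0r.
Qed.

Lemma wpoly_zmod : zmod_morphism (@wpoly k).
Proof.
move=> f h; set n := maxn (size f) (size h).
rewrite (@wpoly_wide (f - h) n); last first.
  by rewrite (leq_trans (size_polyD _ _)) // size_polyN.
rewrite (@wpoly_wide f n) ?leq_maxl // (@wpoly_wide h n) ?leq_maxr //.
by rewrite -sumrB; apply: eq_bigr => i _; rewrite coefB rmorphB mulrBl.
Qed.

HB.instance Definition _ :=
  GRing.isZmodMorphism.Build {poly k} (weyl k) (@wpoly k) wpoly_zmod.

Lemma wpolyZ (c : k) f : wpoly (c *: f) = c%:U * wpoly f.
Proof.
rewrite (@wpoly_wide (c *: f) (size f)) ?size_scale_leq // mulr_sumr.
by apply: eq_bigr => i _; rewrite coefZ rmorphM mulrA.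
Qed.

Lemma wpolyXn n : wpoly ('X^n : {poly k}) = wt k ^+ n.
Proof.
rewrite (@wpoly_wide _ n.+1) ?size_polyXn // (bigD1 ord_max) //= coefXn eqxx.
rewrite rmorph1 mul1r big1 ?addr0 // => i; rewrite -val_eqE /= => /negPf ni.
by rewrite coefXn ni rmorph0 mul0r.
Qed.

Lemma poly_ind_lin (P : {poly k} -> Prop) :
  (forall c f, P f -> P (c *: f)) -> (forall f h, P f -> P h -> P (f + h)) ->
  (forall n, P 'X^n) -> forall f, P f.
Proof.
move=> PZ PD PX f; rewrite -[f]coefK poly_def.
apply: big_ind => //; last by move=> i _; apply/PZ/PX.
by rewrite -(scale0r 'X^0); apply/PZ/PX.
Qed.

Lemma wpolyM (f h : {poly k}) : wpoly (f * h) = wpoly f * wpoly h.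
Proof.
elim/poly_ind_lin: f => [c f IH|f f' IH IH'|n].
- by rewrite -scalerAl !wpolyZ IH mulrA.
- by rewrite mulrDl !raddfD /= mulrDl IH IH'.
elim/poly_ind_lin: h => [c h IH|h h' IH IH'|m].
- by rewrite -scalerAr !wpolyZ IH mulrA ucstC !mulrA.
- by rewrite mulrDr !raddfD /= mulrDr IH IH'.
by rewrite -exprD !wpolyXn exprD.
Qed.

Lemma wd_wpoly (f : {poly k}) : wd k * wpoly f = wpoly f * wd k + wpoly f^`().
Proof.
elim/poly_ind_lin: f => [c f IH|f h IH IH'|n].
- by rewrite derivZ !wpolyZ mulrA -ucstC -!mulrA IH mulrDr.
- by rewrite derivD !raddfD /= mulrDr IH IH' mulrDl addrACA.
elim: n => [|n IH]; first by rewrite derivXn mulr0n raddf0 addr0 wpolyXn mul1r mulr1.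
have dt : wd k * wt k = wt k * wd k + 1.
  by rewrite -(weyl_comm k) addrC subrK.
rewrite exprSr wpolyM mulrA IH mulrDl -mulrA.
have -> : wpoly 'X = wt k by rewrite -['X]expr1 wpolyXn expr1.
rewrite dt mulrDr mulr1 mulrA -addrA; congr (_ + _).
rewrite derivM derivX mulr1 raddfD /= wpolyM addrC; congr (_ + _).
by rewrite -['X]expr1 wpolyXn expr1.
Qed.

Lemma nderivnM (f h : {poly k}) m :
  (f * h)^`N(m) = \sum_(i < m.+1) f^`N(i) * h^`N(m - i).
Proof.
elim/poly_ind_lin: f => [c f IH|f f' IH IH'|a].
- rewrite -scalerAl linearZ /= IH scaler_sumr.
  by apply: eq_bigr => i _; rewrite linearZ /= scalerAl.
- rewrite mulrDl !raddfD /= IH IH' -big_split /=.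
  by apply: eq_bigr => i _; rewrite !raddfD /= mulrDl.
elim/poly_ind_lin: h => [c h IH|h h' IH IH'|b].
- rewrite -scalerAr linearZ /= IH scaler_sumr.
  by apply: eq_bigr => i _; rewrite linearZ /= scalerAr.
- rewrite mulrDr !raddfD /= IH IH' -big_split /=.
  by apply: eq_bigr => i _; rewrite !raddfD /= mulrDr.
rewrite -exprD nderivnXn -binomial.Vandermonde -sumrMnr; apply: eq_bigr => i _.
rewrite !nderivnXn; have [ia|ia] := ltnP a i.
  by rewrite bin_small // mul0n !mulr0n mul0r.
have [ib|ib] := ltnP b (m - i).
  by rewrite ['C(b, _)]bin_small // muln0 !mulr0n mulr0.
rewrite mulrnAl mulrnAr -mulrnA mulnC -exprD; congr ('X^_ *+ _).
by have := ltn_ord i; lia.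
Qed.

Lemma nderivn_deriv (h : {poly k}) i : h^`()^`N(i) = h^`N(i.+1) *+ i.+1.
Proof.
apply/polyP => j; rewrite coefMn !coef_nderivn coef_deriv -!mulrnA addSn.
by congr (_ *+ _); rewrite mulnC [RHS]mulnC; have := mul_bin_diag (i + j).+1 i; rewrite /=; lia.
Qed.

Lemma deriv_nderivn (h : {poly k}) i : h^`N(i)^`() = h^`N(i.+1) *+ i.+1.
Proof.
apply/polyP => j; rewrite coefMn coef_deriv !coef_nderivn -!mulrnA addnS addSn.
congr (_ *+ _); have := mul_bin_left (i + j).+1 i.
by rewrite (_ : (i + j).+1 - i = j.+1)%N; lia.
Qed.

Lemma nderivn_witt_lie (f h : {poly k}) m :
  (witt_lie f h)^`N(m.+1) =
    f * h^`N(m.+1)^`() - h * f^`N(m.+1)^`() +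
    \sum_(i < m.+1) ((m - i)%:R - i%:R : k) *: (f^`N(i.+1) * h^`N((m - i).+1)).
Proof.
rewrite raddfB /= !nderivnM big_ord_recl [X in _ - X]big_ord_recr /=.
rewrite nderivn0 subn0 subnn nderivn0 !nderivn_deriv !deriv_nderivn.
set S3 := (X in _ = _ + X); set S1 := (X in _ * _ + X - _).
set S2 := (X in _ - (X + _)); have <- : S1 - S2 = S3; last by ring.
rewrite -sumrB; apply: eq_bigr => i _; have hi := ltn_ord i.
rewrite /= !nderivn_deriv scalerBl !scaler_nat.
have -> : (m.+1 - i)%N = (m - i).+1 by lia.
by rewrite (_ : bump 0 i = i.+1) // subSS mulrnAr mulrnAl !mulrSr; ring.
Qed.

Local Notation P := (@wpoly k).

Lemma d_wpoly_lie (p q : {poly k}) :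
  (P p * wd k) * P q = P q * (P p * wd k) + P (p * q^`()).
Proof.
rewrite -mulrA wd_wpoly mulrDr -wpolyM; congr (_ + _).
by rewrite mulrA -wpolyM mulrC wpolyM mulrA.
Qed.

HB.instance Definition _ (A B : ualgType k) (a : A) :=
  GRing.isZmodMorphism.Build B (tensor A B) (tens a) (tens_is_additive_r a).

Lemma tens_suml (A B : ualgType k) (b : B) (I : Type) (r : seq I) (F : I -> A) :
  tens (\sum_(i <- r) F i) b = \sum_(i <- r) tens (F i) b.
Proof.
apply: (big_morph (fun a => tens a b) (fun x y => tensDl x y b)).
by rewrite -(subrr (0 : A)) [LHS]tens_is_additive_l subrr.
Qed.

Lemma tensBl (A B : ualgType k) (a a' : A) (b : B) :
  tens (a - a') b = tens a b - tens a' b.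
Proof. exact: tens_is_additive_l. Qed.

Lemma tens0l (A B : ualgType k) (b : B) : tens (0 : A) b = 0.
Proof. by rewrite -(subrr (0 : A)) tensBl subrr. Qed.

Lemma env_in0 (L : lieType k) : env_in (0 : L) = 0.
Proof. by rewrite -(scale0r 0) env_inZ rmorph0 mul0r. Qed.

Lemma conv_sum n (G : nat -> nat -> Talg n) :
  (forall i j, (n <= i + j)%N -> G i j = 0) ->
  \sum_(i < n) \sum_(j < n) G i j = \sum_(m < n) \sum_(i < m.+1) G i (m - i)%N.
Proof.
move=> G0.
transitivity (\sum_(i < n) \sum_(m < n | (i <= m)%N) G i (m - i)%N).
  apply: eq_bigr => i _; have hi := ltn_ord i.
  transitivity (\sum_(j < n - i) G i j).
    rewrite [RHS](big_ord_widen n (fun j => G i j)) ?leq_subr // [RHS]big_mkcond.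
    by apply: eq_bigr => j _; case: ltnP => // h; apply: G0; lia.
  rewrite -(big_geq_mkord i n xpredT (fun m => G i (m - i)%N)).
  rewrite -[X in \sum_(X <= _ < _) _]add0n big_addn big_mkord.
  by apply: eq_bigr => j _; rewrite addnK.
rewrite (exchange_big_dep xpredT) //=; apply: eq_bigr => m _.
by rewrite [RHS](big_ord_widen n (fun i => G i (m - i)%N)).
Qed.

Lemma Psi_gen_morphism n : lie_morphism (@Psi_gen n).
Proof.
split=> [f h|c f|f h].
- rewrite /Psi_gen !raddfD /= mulrDl tensDl addrACA -big_split /=; congr (_ + _).
  by apply: eq_bigr => i _; rewrite !raddfD /= tensDl.
- rewrite /Psi_gen wpolyZ -mulrA tensZl mulrDr mulr_sumr; congr (_ + _).
  by apply: eq_bigr => i _; rewrite linearZ /= wpolyZ tensZl.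
pose V i := env_in (gv n i).
pose D p := tens (P p * wd k) 1 : Talg n.
pose S (p : {poly k}) := \sum_(i < n) tens (P p^`N(i.+1)) (V i) : Talg n.
have E p q : (D p + S p) * (D q + S q) =
    tens (P p * wd k * (P q * wd k)) 1
    + \sum_(j < n) tens (P p * wd k * P q^`N(j.+1)) (V j)
    + \sum_(i < n) tens (P p^`N(i.+1) * (P q * wd k)) (V i)
    + \sum_(i < n) \sum_(j < n) tens (P (p^`N(i.+1) * q^`N(j.+1))) (V i * V j).
  rewrite mulrDl !mulrDr addrA; congr (_ + _ + _ + _).
  - by rewrite tensM mulr1.
  - by rewrite mulr_sumr; apply: eq_bigr => i _; rewrite tensM mul1r.
  - by rewrite mulr_suml; apply: eq_bigr => i _; rewrite tensM mulr1.
  rewrite mulr_suml; apply: eq_bigr => i _; rewrite mulr_sumr.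
  by apply: eq_bigr => j _; rewrite tensM wpolyM.
rewrite -[Psi_gen n f]/(D f + S f) -[Psi_gen n h]/(D h + S h) !E.
have AC (a b c d a' b' c' d' : Talg n) : a + b + c + d - (a' + b' + c' + d') =
    (a - a') + ((b - c') - (b' - c) + (d - d')).
  rewrite -(addrA a) -(addrA a') opprD addrACA [RHS]addrA; congr (_ + _).
  rewrite opprD addrACA; congr (_ + _).
  by rewrite opprB [b' + c']addrC opprD addrACA.
rewrite AC -[LHS]/(D (witt_lie f h) + S (witt_lie f h)); apply/esym.
pose G i j : Talg n := tens (P ((j%:R - i%:R : k) *: (f^`N(i.+1) * h^`N(j.+1)))) (V (i + j)%N).
congr (_ + _).
  rewrite -tensBl /D; congr tens.
  rewrite !mulrA.
  have W (p q : {poly k}) : P p * wd k * P q * wd k =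
      P q * P p * (wd k * wd k) + P (p * q^`()) * wd k.
    by rewrite d_wpoly_lie mulrDl !mulrA.
  rewrite !W -!wpolyM [f * h]mulrC opprD addrACA subrr add0r -mulrBl -raddfB /=.
  by rewrite [h * _]mulrC.
transitivity (\sum_(i < n) tens (P (f * h^`N(i.+1)^`())) (V i)
    - \sum_(i < n) tens (P (h * f^`N(i.+1)^`())) (V i)
    + \sum_(i < n) \sum_(j < n) G i j).
  congr (_ - _ + _).
  - rewrite -sumrB; apply: eq_bigr => i _; rewrite -tensBl d_wpoly_lie; congr tens.
    by rewrite addrC addKr.
  - rewrite -sumrB; apply: eq_bigr => i _; rewrite -tensBl d_wpoly_lie; congr tens.
    by rewrite addrC addKr.
  rewrite [X in _ - X]exchange_big -sumrB; apply: eq_bigr => i _.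
  rewrite -sumrB; apply: eq_bigr => j _.
  rewrite [h^`N(_) * _]mulrC -raddfB /= -env_in_lie gv_lie env_inZ tensZr.
  by rewrite /G wpolyZ tensZl.
rewrite conv_sum => [|i j ij]; last by rewrite /G /V gv_eq0 // env_in0 raddf0.
rewrite -!sumrB -big_split /=; apply: eq_bigr => m _.
rewrite nderivn_witt_lie [X in _ = tens X _]raddfD /= tensDl; congr (_ + _).
  by rewrite raddfB /= tensBl.
rewrite raddf_sum tens_suml.
by apply: eq_bigr => i _; rewrite /G subnKC // -ltnS.
Qed.

Definition Psi (n : nat) : env witt -> Talg n := env_lift (Psi_gen_morphism n).
Arguments Psi : clear implicits.

Lemma Psi_hom n : alg_hom (Psi n).
Proof. exact: env_lift_hom. Qed.
Arguments Psi_hom : clear implicits.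

Lemma PsiE n f : Psi n (env_in f) = Psi_gen n f.
Proof. exact: env_liftE. Qed.

Definition Balg (n : nat) : set (Talg n) := range (Psi n).
Arguments Balg : clear implicits.

Lemma Talg_proj_hom n : alg_hom (@Talg_proj n).
Proof. exact: tens_lift_hom. Qed.
Arguments Talg_proj_hom : clear implicits.

Lemma Talg_proj_tens n a u :
  @Talg_proj n (tens a u) = tens a (env_map (gLie_proj_hom n) u).
Proof. exact: tens_liftE. Qed.

Lemma Talg_proj_v n i : Talg_proj (Talg_v n.+1 i) = Talg_v n i.
Proof. by rewrite Talg_proj_tens [env_map _ _]env_liftE gLie_proj_v. Qed.

Lemma Talg_proj_v_last n : Talg_proj (Talg_v n.+1 n) = 0.
Proof. by rewrite Talg_proj_v /Talg_v gv_eq0 // env_in0 raddf0. Qed.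

Lemma Talg_proj_Psi n u : Talg_proj (Psi n.+1 u) = Psi n u.
Proof.
have [pB [p1 pM] pc] := Talg_proj_hom n; have [sB [s1 sM] sc] := Psi_hom n.+1.
have pD := alg_homD (Talg_proj_hom n).
have h : alg_hom (fun u => Talg_proj (Psi n.+1 u)).
  by split=> [x y||c]; [rewrite sB pB | split=> [|x y]; rewrite ?s1 ?sM | rewrite sc].
move: u; apply: (alg_hom_ext h (Psi_hom n)) => f.
rewrite [X in Talg_proj X]PsiE [RHS]PsiE /Psi_gen pD Talg_proj_tens.
have [_ [e1 _] _] := env_map_hom (gLie_proj_hom n).
rewrite e1; congr (_ + _).
have p0 : Talg_proj (0 : Talg n.+1) = 0 by rewrite -(subrr (0 : Talg n.+1)) pB subrr.
rewrite (big_morph _ pD p0) big_ord_recr /= Talg_proj_tens.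
rewrite [env_map _ _]env_liftE gLie_proj_v gv_eq0 // env_in0 raddf0 addr0.
by apply: eq_bigr => i _; rewrite Talg_proj_tens [env_map _ _]env_liftE gLie_proj_v.
Qed.

(* [Talg_proj] restricts to the natural surjection of [B_(n+1)] onto [B_n]. *)
Lemma Talg_proj_Balg n : (@Talg_proj n @` Balg n.+1 = Balg n)%classic.
Proof.
apply/seteqP; split=> [_ [_ [u _ <-] <-]|_ [u _ <-]].
  by rewrite Talg_proj_Psi; exists u.
by exists (Psi n.+1 u); [exists u | rewrite Talg_proj_Psi].
Qed.

End Witt.

Arguments Talg_proj k n x : clear implicits.
Arguments Talg_v k n i : clear implicits.
Arguments Psi k n u : clear implicits.
Arguments Balg k n : clear implicits.

(* Main.v *)
Require Import Defs.
From HB Require Import structures.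
From mathcomp Require Import all_boot all_algebra ssrAC.
From mathcomp Require Import ring zify.
From mathcomp Require Import boolp classical_sets.

(** The two inclusions have different reasons.

    The kernel of [B_(n+1) -> B_n] lies in [T_(n+1) v_n^2] because, geometrically,
    [v_n] is tangent to the stratum of order [n].  The functional
    [f |-> sum_i f^(i)(t) / i! * v_(i-1)], with [v_(-1) = ∂], changes when [t] is moved
    to [t + ε] by a functional of order [n+1] whose top coefficient is a multiple of
    [ε v_(n-1)]; so to first order a deformation along [v_n] is the same as a shift of [t]
    and of the lower [v_i].  This shift is realised by a homomorphism [ρ] from [T_(n+1)]
    to [T_n[ε]], where [ε^2 = 0] and [v_0 ε = ε (v_0 + 1)]:
      [t |-> t - ε],  [∂ |-> ∂],  [v_i |-> v_i + (i+1) ε v_(i-1)],  [v_n |-> (n+1) ε v_(n-1)].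
    The corrections cancel in [f∂], so that [ρ ∘ Psi_(n+1)] is [Psi_n] followed by the
    inclusion of [T_n]: lemmas [shift_hom] and [shift_base_Psi].  An element
    [Psi_(n+1) u] killed by the projection is [v_n y] (lemma [Talg_proj_eq0]), and [ρ]
    kills it as well, whence [v_(n-1) ȳ = 0] for the image [ȳ] of [y] in [T_n].  As [v_(n-1)] is regular in [T_n]
    (lemma [Talg_v_last_regular]), [ȳ = 0], so [y] is again a multiple of the normal
    element [v_n].  The ring [T_n[ε]] is modelled by upper triangular matrices over [T_n].

    Regularity is obtained without a PBW basis.  A representation of [g_n] in which
    [v_(n-1)] acts by a multiple of a matrix unit gives a locally nilpotent linear
    operator [D] on [T_n] with [D (v_(n-1) x) = v_(n-1) (D x) + n x], and in
    characteristic [0] such a relation forces left multiplication by [v_(n-1)] to be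
    injective.

    Conversely, write [f ⊗ g |-> Psi f * Psi g] in terms of the divided derivatives
    [f^[p] g^[q]].  Replacing [f ⊗ g] by [t f ⊗ g - f ⊗ t g] shifts these derivatives
    (lemma [hasse_shift]), and after [2n+2] such steps only the term [v_n^2] survives, with
    coefficient a nonzero multiple of [f g]; so [k[t] v_n^2] lies in [B_(n+1)].  The [s]
    with [k[t] s] inside [B_(n+1)] form a left ideal of [T_(n+1)], because the elements
    [Psi (t^i)] give [∂], [v_0], [v_1], ... one after the other (lemma
    [multipliers_gen]). *)

Set Implicit Arguments.
Unset Strict Implicit.
Unset Printing Implicit Defensive.

Import GRing.Theory.
Local Open Scope ring_scope.

(** * Homomorphisms, matrix algebras and quotient algebras *)

Lemma presented_ind (k : fieldType) (X : Type) (rels : term k X -> term k X -> Prop)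
    (P : presented rels -> Prop) :
  (forall x, P (pgen x)) -> (forall c, P c%:U) ->
  (forall x y, P x -> P y -> P (x + y)) ->
  (forall x y, P x -> P y -> P (x * y)) -> forall x, P x.
Proof.
move=> Pg Pc PD PM; elim/presentedW; elim=> [x|c|s Ps t Pt|s Ps t Pt].
- exact: Pg.
- exact: Pc.
- by rewrite -paddE; apply: PD.
- by rewrite -pmulE; apply: PM.
Qed.

Section AlgHom.
Context (k : fieldType) (A B : ualgType k) (f : A -> B) (Hf : alg_hom f).

Lemma alg_homB x y : f (x - y) = f x - f y. Proof. by case: Hf => fB. Qed.
Lemma alg_hom0 : f 0 = 0. Proof. by rewrite -(subrr (0 : A)) alg_homB subrr. Qed.
Lemma alg_homM x y : f (x * y) = f x * f y. Proof. by case: Hf => _ [_ fM]. Qed.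
Lemma alg_hom1 : f 1 = 1. Proof. by case: Hf => _ [f1 _]. Qed.
Lemma alg_homU c : f c%:U = c%:U. Proof. by case: Hf. Qed.
Lemma alg_hom_sum I (r : seq I) (Q : pred I) F :
  f (\sum_(i <- r | Q i) F i) = \sum_(i <- r | Q i) f (F i).
Proof. exact: (big_morph f (alg_homD Hf) alg_hom0). Qed.

End AlgHom.

Section MatrixAlgebra.
Context (k : fieldType) (A : ualgType k) (m : nat).

Definition mx_ucst (c : k) : 'M[A]_m := (c%:U)%:M.

Lemma mx_ucst_zmod : zmod_morphism mx_ucst.
Proof. by move=> c d; rewrite /mx_ucst rmorphB raddfB. Qed.

Lemma mx_ucst_monoid : monoid_morphism mx_ucst.
Proof. by split=> [|c d]; rewrite /mx_ucst ?rmorph1 // rmorphM scalar_mxM. Qed.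

Lemma mx_ucstC c (M : 'M[A]_m) : mx_ucst c * M = M * mx_ucst c.
Proof.
rewrite -[LHS]/(mx_ucst c *m M) mul_scalar_mx; apply/matrixP=> i j.
rewrite !mxE (bigD1 j) //= !mxE eqxx mulr1n -ucstC big1 ?addr0 // => l lj.
by rewrite !mxE (negPf lj) mulr0n mulr0.
Qed.

HB.instance Definition _ :=
  isUAlg.Build k 'M[A]_m mx_ucst_zmod mx_ucst_monoid mx_ucstC.

End MatrixAlgebra.

Section QuotientAlgebra.
Context (k : fieldType) (A : ualgType k) (I : A -> Prop).

(** The quotient of [A] by the two-sided ideal [I] is presented by all elements of [A], with
    every relation that holds modulo [I]. *)
Definition quot_rels (s t : term k A) : Prop :=
  I (term_eval id s - term_eval id t).

Definition quot_alg : Type := presented quot_rels.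
HB.instance Definition _ := UAlg.on quot_alg.

Definition quot_pi (x : A) : quot_alg := pgen x.

Hypotheses (I0 : I 0) (ID : forall x y, I x -> I y -> I (x + y)).
Hypotheses (IMl : forall x y, I y -> I (x * y)) (IMr : forall x y, I x -> I (x * y)).

Lemma quot_pi_eval t : pcls quot_rels t = quot_pi (term_eval id t).
Proof. by apply/pclsP/pc_rel; rewrite /quot_rels /= subrr. Qed.

Lemma quot_pi_hom : alg_hom quot_pi.
Proof.
have EM x y : quot_pi (x * y) = quot_pi x * quot_pi y.
  by rewrite [RHS]pmulE quot_pi_eval.
have ED x y : quot_pi (x + y) = quot_pi x + quot_pi y.
  by rewrite [RHS]paddE quot_pi_eval.
have EC c : quot_pi c%:U = c%:U by rewrite [RHS]quot_pi_eval.
split=> // [x y|]; first by rewrite -[in RHS](subrK y x) [in RHS]ED addrK.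
by split=> //; rewrite -(rmorph1 (@ucst k A)) EC rmorph1.
Qed.

(** Congruence modulo [I] is compatible with the operations, hence contains the congruence
    that defines the quotient; this is what keeps the quotient from being too small. *)
Lemma quot_pcongr s t : pcongr quot_rels s t -> I (term_eval id s - term_eval id t).
Proof.
have IN x : I x -> I (- x) by move=> /(IMl (-1)); rewrite mulN1r.
elim=> //=.
- by move=> *; rewrite subrr.
- by move=> ? ? _ /IN; rewrite opprB.
- by move=> ? u ? _ Isu _ Iut; rewrite -(subrKA (term_eval id u)); apply: ID.
- by move=> ? ? ? ? _ Is _ It; rewrite opprD addrACA; apply: ID.
- move=> u u' v v' _ Iu _ Iv.
  rewrite -(subrKA (term_eval id u' * term_eval id v)) -mulrBl -mulrBr.
  by apply: ID; [apply: IMr | apply: IMl].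
- by move=> *; rewrite addrA subrr.
- by move=> *; rewrite [X in X - _]addrC subrr.
- by move=> *; rewrite rmorph0 add0r subrr.
- by move=> *; rewrite rmorph0 mul0r subrr.
- by move=> *; rewrite mulrA subrr.
- by move=> *; rewrite rmorph1 mul1r subrr.
- by move=> *; rewrite mulrDl subrr.
- by move=> *; rewrite mulrDr subrr.
- by move=> *; rewrite rmorphD subrr.
- by move=> *; rewrite rmorphM subrr.
- by move=> *; rewrite ucstC subrr.
Qed.

Lemma quot_pi_eq0 x : quot_pi x = 0 <-> I x.
Proof.
split=> [|Ix].
  by rewrite -[0]/(pcls quot_rels (Cst 0)) => /pclsP/quot_pcongr /=; rewrite rmorph0 subr0.
by apply/pclsP/pc_rel; rewrite /quot_rels /= rmorph0 subr0.
Qed.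

End QuotientAlgebra.

(** * The basis of [g_n] and the universal property of [T_n] *)

Section TruncatedWitt.
Context (k : fieldType) (n : nat).

(** The coordinate of [v_i]: the coefficient of [t^(i+1)] in any representative, read off
    here from a chosen one; it is independent of the choice for [i < n] only. *)
Definition gcoef (i : nat) (x : gLie k n) : k :=
  (witt0_val (lrep x) : {poly k})`_i.+1.

Lemma dvdXn_coef (p : {poly k}) m i : 'X^m %| p -> (i < m)%N -> p`_i = 0.
Proof. by move=> /dvdpP[q ->] im; rewrite coefMXn im. Qed.

Lemma gcoef_lpi i (x : witt0 k) : (i < n)%N ->
  gcoef i (lpi (wittge_ideal k n) x) = (witt0_val x : {poly k})`_i.+1.
Proof.
move=> ni; apply/eqP; rewrite -subr_eq0 /gcoef -coefB; apply/eqP.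
have := lrep_pi (wittge_ideal k n) x; rewrite !unfold_in => /dvdXn_coef; exact.
Qed.

Lemma gcoefP i c x y : (i < n)%N ->
  gcoef i (c *: x + y) = c * gcoef i x + gcoef i y.
Proof.
move=> ni; elim/lquotW: x => x; elim/lquotW: y => y.
by rewrite -linearP !gcoef_lpi //= coefD coefZ.
Qed.

Lemma gcoefD i x y : (i < n)%N -> gcoef i (x + y) = gcoef i x + gcoef i y.
Proof. by move=> ni; rewrite -[x in LHS]scale1r gcoefP // mul1r. Qed.

Lemma gcoefZ i c x : (i < n)%N -> gcoef i (c *: x) = c * gcoef i x.
Proof.
move=> ni; rewrite -[c *: x]addr0 gcoefP //.
have -> : gcoef i 0 = 0.
  by rewrite -(raddf0 (lpi (wittge_ideal k n))) gcoef_lpi //= coef0.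
by rewrite addr0.
Qed.

Lemma gcoef_v i j : (i < n)%N -> gcoef i (gv k n j) = (i == j)%:R.
Proof. by move=> ni; rewrite gcoef_lpi //= coefXn eqSS. Qed.

Lemma gLie_span (x : gLie k n) : x = \sum_(i < n) gcoef i x *: gv k n i.
Proof.
elim/lquotW: x => x.
transitivity (lpi (wittge_ideal k n)
    (\sum_(i < n) (witt0_val x : {poly k})`_i.+1 *: witt0_e k i)); last first.
  by rewrite [LHS]raddf_sum; apply: eq_bigr => i _; rewrite gcoef_lpi // [LHS]linearZ.
apply/lpiP; rewrite 2!unfold_in -[witt0_val (_ - _)]/(val _) raddfB raddf_sum.
have x0 : (witt0_val x : {poly k})`_0 = 0.
  by apply: (@dvdXn_coef _ 1) => //; apply: (witt0P x).
rewrite -[X in X - _](poly_take_drop n.+1) /take_poly poly_def big_ord_recl x0 scale0r add0r.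
rewrite addrAC [X in 'X^_ %| X + _](_ : _ = 0) ?add0r ?dvdp_mull //.
apply/eqP; rewrite subr_eq0; apply/eqP/eq_bigr => i _; rewrite [RHS]linearZ.
by [].
Qed.

Lemma gLie_ind (P : gLie k n -> Prop) : P 0 ->
  (forall i, (i < n)%N -> P (gv k n i)) ->
  (forall x y, P x -> P y -> P (x + y)) -> (forall c x, P x -> P (c *: x)) ->
  forall x, P x.
Proof.
move=> P0 Pv PD PZ x; rewrite [x]gLie_span; apply: big_ind => // i _.
exact/PZ/Pv.
Qed.

Section Lift.
Context (A : ualgType k) (c : nat -> A).

Definition glift (x : gLie k n) : A := \sum_(i < n) (gcoef i x)%:U * c i.

Lemma gliftD x y : glift (x + y) = glift x + glift y.
Proof.
by rewrite -big_split; apply: eq_bigr => i _; rewrite gcoefD // rmorphD mulrDl.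
Qed.

Lemma gliftZ a x : glift (a *: x) = a%:U * glift x.
Proof.
by rewrite mulr_sumr; apply: eq_bigr => i _; rewrite gcoefZ // rmorphM mulrA.
Qed.

Lemma glift0 : glift 0 = 0.
Proof. by rewrite -(scale0r 0) gliftZ rmorph0 mul0r. Qed.

Hypothesis c0 : forall i, (n <= i)%N -> c i = 0.

Lemma glift_v i : glift (gv k n i) = c i.
Proof.
have [ni|ni] := leqP n i; first by rewrite gv_eq0 // glift0 c0.
rewrite /glift (bigD1 (Ordinal ni)) //= gcoef_v // eqxx rmorph1 mul1r.
rewrite big1 ?addr0 // => j ij; rewrite gcoef_v //.
by rewrite -val_eqE /= in ij; rewrite (negPf ij) rmorph0 mul0r.
Qed.

Hypothesis cB : forall i j, (i < n)%N -> (j < n)%N ->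
  c i * c j - c j * c i = (j%:R - i%:R : k)%:U * c (i + j)%N.

(** By bilinearity the Lie relation has to be checked on the [v_i] only, so a representation
    of [g_n] is given by a sequence of elements. *)
Lemma glift_morphism : lie_morphism glift.
Proof.
split=> [x y|a x|x y]; [exact: gliftD | exact: gliftZ |].
have lieDr (u v w : gLie k n) : lie u (v + w) = lie u v + lie u w.
  exact: raddfD.
have lieZr (u v : gLie k n) a : lie u (a *: v) = a *: lie u v by exact: linearZ.
elim/gLie_ind: x => [|i ni|x x' IH IH'|a x IH].
- by rewrite lieC [lie y 0]raddf0 oppr0 glift0 mul0r mulr0 subrr.
- elim/gLie_ind: y => [|j nj|y y' IH IH'|a y IH].
  + by rewrite [lie _ 0]raddf0 glift0 mul0r mulr0 subrr.
  + by rewrite gv_lie gliftZ !glift_v cB.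
  + by rewrite lieDr !gliftD IH IH' mulrDl mulrDr opprD addrACA.
  + by rewrite lieZr !gliftZ IH mulrBr !mulrA -(ucstC a (glift (gv k n i))).
- by rewrite lieDl !gliftD IH IH' mulrDl mulrDr opprD addrACA.
- rewrite lieC lieZr -scalerN -lieC !gliftZ IH mulrBr !mulrA.
  by rewrite -(ucstC a (glift y)).
Qed.

End Lift.
End TruncatedWitt.

Section UniversalPropertyTalg.
Context (k : fieldType) (n : nat).

Lemma alg_hom_tensl (A B : ualgType k) : alg_hom (fun a : A => tens a (1 : B)).
Proof.
split=> [a a'||c]; first exact: tensBl.
  by split=> [|a a']; [exact: tens11 | rewrite tensM mulr1].
by rewrite -[c%:U in LHS]mulr1 tensZl tens11 mulr1.
Qed.

Lemma alg_hom_tensr (A B : ualgType k) : alg_hom (fun b : B => tens (1 : A) b).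
Proof.
split=> [b b'||c]; first exact: tens_is_additive_r.
  by split=> [|b b']; [exact: tens11 | rewrite tensM mulr1].
by rewrite -[c%:U in LHS]mulr1 tensZr tens11 mulr1.
Qed.

Lemma tens_split (A B : ualgType k) (a : A) (b : B) :
  tens a b = tens a 1 * tens 1 b.
Proof. by rewrite tensM mulr1 mul1r. Qed.

Lemma tens_comm (A B : ualgType k) (a : A) (b : B) :
  tens a 1 * tens 1 b = tens 1 b * tens a 1.
Proof. by rewrite !tensM !mulr1 !mul1r. Qed.

Lemma Talg_ind (P : Talg k n -> Prop) :
  P (tens (wt k) 1) -> P (tens (wd k) 1) ->
  (forall i, (i < n)%N -> P (Talg_v k n i)) -> (forall c : k, P c%:U) ->
  (forall x y, P x -> P y -> P (x + y)) -> (forall x y, P x -> P y -> P (x * y)) ->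
  forall x, P x.
Proof.
move=> Pt Pd Pv Pc PD PM; have HL := alg_hom_tensl (weyl k) (env (gLie k n)).
have HR := alg_hom_tensr (weyl k) (env (gLie k n)).
apply: presented_ind => // -[a u].
rewrite -[pgen _]/(tens a u) tens_split; apply: (PM).
  elim/presented_ind: a => [[]|c|x y Px Py|x y Px Py] //.
  - by rewrite (alg_homU HL).
  - by rewrite tensDl; apply: PD.
  - by rewrite (alg_homM HL); apply: PM.
elim/presented_ind: u => [g|c|x y Px Py|x y Px Py] //.
- rewrite -[pgen _]/(env_in g); elim/gLie_ind: g => [|i ni|x y Px Py|c x Px].
  + by rewrite env_in0 (alg_hom0 HR) -(rmorph0 (@ucst k (Talg k n))); apply: Pc.
  + exact: Pv.
  + by rewrite env_inD tensDr; apply: PD.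
  + by rewrite env_inZ tensZr; apply: PM.
- by rewrite (alg_homU HR).
- by rewrite tensDr; apply: PD.
- by rewrite (alg_homM HR); apply: PM.
Qed.

Lemma Talg_hom_ext (C : ualgType k) (f g : Talg k n -> C) :
  alg_hom f -> alg_hom g ->
  f (tens (wt k) 1) = g (tens (wt k) 1) -> f (tens (wd k) 1) = g (tens (wd k) 1) ->
  (forall i, (i < n)%N -> f (Talg_v k n i) = g (Talg_v k n i)) -> f =1 g.
Proof.
move=> Hf Hg ft fd fv; apply: Talg_ind => // [c|x y Ex Ey|x y Ex Ey].
- by rewrite (alg_homU Hf) (alg_homU Hg).
- by rewrite (alg_homD Hf) (alg_homD Hg) Ex Ey.
- by rewrite (alg_homM Hf) (alg_homM Hg) Ex Ey.
Qed.

Lemma Talg_v0 i : (n <= i)%N -> Talg_v k n i = 0.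
Proof. by move=> ni; rewrite /Talg_v gv_eq0 // env_in0 raddf0. Qed.

Lemma Talg_v_comm i j : Talg_v k n i * Talg_v k n j - Talg_v k n j * Talg_v k n i =
  (j%:R - i%:R : k)%:U * Talg_v k n (i + j).
Proof.
have HR := alg_hom_tensr (weyl k) (env (gLie k n)).
rewrite -!(alg_homM HR) -(alg_homB HR) -env_in_lie gv_lie env_inZ.
by rewrite tensZr.
Qed.

Lemma Talg_wv (a : weyl k) i :
  tens a 1 * Talg_v k n i = Talg_v k n i * tens a 1.
Proof. exact: tens_comm. Qed.

(** The universal property of [T_n], stated with the basis of [g_n]. *)
Lemma Talg_lift (C : ualgType k) (al : weyl k -> C) (c : nat -> C) :
  alg_hom al -> (forall i, (n <= i)%N -> c i = 0) ->
  (forall i j, (i < n)%N -> (j < n)%N ->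
    c i * c j - c j * c i = (j%:R - i%:R : k)%:U * c (i + j)%N) ->
  (forall i a, (i < n)%N -> al a * c i = c i * al a) ->
  exists f : Talg k n -> C, [/\ alg_hom f, forall a, f (tens a 1) = al a &
    forall i, f (Talg_v k n i) = c i].
Proof.
move=> Ha c0 cB ac; pose be := env_lift (glift_morphism c0 cB).
have Hb : alg_hom be by exact: env_lift_hom.
have abC a u : al a * be u = be u * al a.
  elim/presented_ind: u => [g|b|x y Ex Ey|x y Ex Ey].
  - rewrite -[pgen g]/(env_in g) /be env_liftE /glift mulr_sumr mulr_suml.
    by apply: eq_bigr => i _; rewrite mulrA -ucstC -!mulrA ac.
  - by rewrite (alg_homU Hb) ucstC.
  - by rewrite (alg_homD Hb) mulrDr mulrDl Ex Ey.
  - by rewrite (alg_homM Hb) mulrA Ex -!mulrA Ey.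
have Hf : tens_bimorphism (fun a u => al a * be u).
  split=> [a a' u|a u u'|b a u|b a u||a a' u u'].
  - by rewrite (alg_homD Ha) mulrDl.
  - by rewrite (alg_homD Hb) mulrDr.
  - by rewrite (alg_homM Ha) (alg_homU Ha) mulrA.
  - by rewrite (alg_homM Hb) (alg_homU Hb) mulrA -ucstC mulrA.
  - by rewrite (alg_hom1 Ha) (alg_hom1 Hb) mulr1.
  - by rewrite (alg_homM Ha) (alg_homM Hb) !mulrA -(mulrA (al a)) abC !mulrA.
exists (tens_lift Hf); split=> [|a|i]; first exact: tens_lift_hom.
  by rewrite tens_liftE (alg_hom1 Hb) mulr1.
by rewrite tens_liftE (alg_hom1 Ha) mul1r /be env_liftE glift_v.
Qed.

End UniversalPropertyTalg.

(** * The kernel of the projection from [T_(n+1)] to [T_n] *)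

Section TopGenerator.
Context (k : fieldType) (n : nat).
Local Notation T := (Talg k n.+1).
Local Notation v := (Talg_v k n.+1).

Lemma top_comm i : v n * v i - v i * v n = (i%:R - n%:R : k)%:U * v (n + i)%N.
Proof. exact: Talg_v_comm. Qed.

Lemma top_commr i : (0 < i)%N -> v n * v i = v i * v n.
Proof.
move=> i0; apply/eqP; rewrite -subr_eq0 top_comm Talg_v0 ?mulr0 //.
by rewrite -{1}[n]addn0 ltn_add2l.
Qed.

Lemma top_comm0 : v n * v 0 = (v 0 - n%:R%:U) * v n.
Proof.
by apply/eqP; rewrite -subr_eq0 mulrBl opprB addrCA addrC top_comm addn0 sub0r rmorphN mulNr addNr.
Qed.

(** [v_n] commutes with all generators but [v_0], which it shifts by [n]; so its left and
    right multiples are the same. *)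
Lemma top_normal (y : T) :
  (exists y', y * v n = v n * y') /\ (exists y', v n * y = y' * v n).
Proof.
elim/Talg_ind: y => [||i _|c|x y [[x1 E1] [x2 E2]] [[y1 F1] [y2 F2]]|x y [[x1 E1] [x2 E2]] [[y1 F1] [y2 F2]]].
- by split; exists (tens (wt k) 1); rewrite Talg_wv.
- by split; exists (tens (wd k) 1); rewrite Talg_wv.
- case: (posnP i) => [->|i0]; last by split; exists (v i); rewrite top_commr.
  split; last by exists (v 0%N - n%:R%:U); rewrite top_comm0.
  exists (v 0%N + n%:R%:U).
  by rewrite mulrDr top_comm0 mulrBl -ucstC subrK.
- by split; exists c%:U; rewrite ucstC.
- by split; [exists (x1 + y1) | exists (x2 + y2)]; rewrite mulrDr mulrDl ?E1 ?F1 ?E2 ?F2.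
- split; first by exists (x1 * y1); rewrite -mulrA F1 !mulrA E1.
  by exists (x2 * y2); rewrite mulrA E2 -!mulrA F2.
Qed.

(** Modulo the ideal [v_n T_(n+1)] the generators [v_0, ..., v_(n-1)] satisfy the relations
    of [T_n], which gives a map from [T_n] to the quotient of [T_(n+1)] by this ideal, and
    the quotient map factors through the projection to [T_n]. *)
Lemma Talg_proj_eq0 (x : T) : Talg_proj k n x = 0 -> exists y, x = v n * y.
Proof.
move=> px; pose I (z : T) := exists y, z = v n * y.
have I0 : I 0 by exists 0; rewrite mulr0.
have ID z y : I z -> I y -> I (z + y).
  by move=> [z' ->] [y' ->]; exists (z' + y'); rewrite mulrDr.
have IMl z y : I y -> I (z * y).
  move=> [y' ->]; have [[z' E] _] := top_normal z.
  by exists (z' * y'); rewrite !mulrA E.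
have IMr z y : I z -> I (z * y) by move=> [z' ->]; exists (z' * y); rewrite mulrA.
have Hpi := quot_pi_hom I0.
pose c i := if (i < n)%N then quot_pi I (v i) else 0.
have piv i : quot_pi I (v i) = c i.
  rewrite /c; case: ltnP => // ni; apply/quot_pi_eq0 => //; rewrite leq_eqVlt in ni.
  case/orP: ni => [/eqP <-|ni]; first by exists 1; rewrite mulr1.
  by rewrite Talg_v0.
have [||||th [Hth thw thv]] := @Talg_lift k n (quot_alg I) (fun a => quot_pi I (tens a 1)) c.
- have [tB [t1 tM] tC] := alg_hom_tensl (weyl k) (env (gLie k n.+1)).
  split=> [a b||b]; first by rewrite tB (alg_homB Hpi).
    by split=> [|a b]; rewrite ?t1 ?tM ?(alg_hom1 Hpi) ?(alg_homM Hpi).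
  by rewrite tC (alg_homU Hpi).
- by move=> i ni; rewrite /c ltnNge ni.
- move=> i j _ _; rewrite -!piv -(alg_homU Hpi) -!(alg_homM Hpi) -(alg_homB Hpi).
  by rewrite Talg_v_comm.
- by move=> i a _; rewrite -piv -!(alg_homM Hpi) Talg_wv.
have e1 : env_map (gLie_proj_hom k n) 1 = 1.
  exact: (alg_hom1 (env_map_hom (gLie_proj_hom k n))).
have Hp := Talg_proj_hom k n.
have E : (fun z => th (Talg_proj k n z)) =1 quot_pi I.
  apply: Talg_hom_ext => //.
  - split=> [a b||b]; first by rewrite (alg_homB Hp) (alg_homB Hth).
      by split=> [|a b]; rewrite ?(alg_hom1 Hp) ?(alg_hom1 Hth) ?(alg_homM Hp) ?(alg_homM Hth).
    by rewrite (alg_homU Hp) (alg_homU Hth).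
  - by rewrite Talg_proj_tens e1 thw.
  - by rewrite Talg_proj_tens e1 thw.
  - by move=> i _; rewrite Talg_proj_v thv piv.
by apply/(quot_pi_eq0 I0 ID IMl IMr); rewrite -E px (alg_hom0 Hth).
Qed.

End TopGenerator.

(** * Regularity of the last generator *)

Lemma commutatorD (R : pzRingType) (a b x y : R) : a * y = y * a -> b * x = x * b ->
  (a + x) * (b + y) - (b + y) * (a + x) = a * b - b * a + (x * y - y * x).
Proof.
move=> ay bx; rewrite !mulrDl !mulrDr ay bx !opprD !addrA.
by rewrite (ACl (1*5*4*8*(2*7)*(3*6)))%AC /= !subrr !addr0.
Qed.

Section LastGeneratorRegular.
Context (k : fieldType) (m : nat).
Local Notation n := m.+1.
Local Notation T := (Talg k n).
Local Notation v := (Talg_v k n).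

(** [logjet i] is the matrix of [v_i] on [k w_0 ⊕ k[t]/(t^n)], where [f∂] sends [w_0] to
    [f'] and [g] to [f g'], in the basis [w_0, 1, t, ..., t^(n-1)].
    So [v_i] sends the basis vector of index [b] to a multiple of that of index [i + b], but
    [w_0] to a multiple of [t^i], which has index [i + 1].  The vector [w_0] plays the
    role of a logarithm.  On this module [v_(n-1)] sends [w_0] to [n t^(n-1)] and kills
    all the rest, for every [n >= 1]. *)
Definition logjet_coef (i b : nat) : nat := if b is b'.+1 then b' else i.+1.

Definition logjet (i : nat) : 'M[T]_n.+1 :=
  \matrix_(a, b) (logjet_coef i b *+ (a == i + maxn 1 b :> nat)%N)%:R.

Lemma logjet_eq0 i : (n <= i)%N -> logjet i = 0.
Proof.
move=> ni; apply/matrixP => a b; rewrite !mxE; case: eqP => // e.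
by have := ltn_ord a; rewrite e; have := leq_maxl 1 b; lia.
Qed.

Lemma logjetM i j : logjet i * logjet j =
  \matrix_(a, b) (logjet_coef j b * (j + maxn 1 b).-1
                  *+ (a == (i + j) + maxn 1 b :> nat)%N)%:R.
Proof.
apply/matrixP => a b; rewrite !mxE.
under eq_bigr => l _ do rewrite !mxE -natrM.
rewrite -natr_sum; congr (_%:R).
have b1 := leq_maxl 1 b; set b' := maxn 1 b in b1 *.
have [jb|jb] := ltnP (j + b') n.+1.
  rewrite (bigD1 (Ordinal jb)) //= eqxx big1 ?addn0 => [|l].
    have -> : maxn 1 (j + b') = (j + b')%N by lia.
    rewrite addnA; case: (_ == _); rewrite /= ?mul0n // mulnC; congr (_ * _)%N.
    by rewrite /logjet_coef; case E : (j + b')%N => //; lia.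
  by rewrite -val_eqE /= => /negPf ->; rewrite muln0.
rewrite big1 => [|l _].
  by case: eqP => // e; have := ltn_ord a; rewrite e; lia.
by case: (_ =P j + b')%N => [e|_]; rewrite ?muln0 //; have := ltn_ord l; rewrite e; lia.
Qed.

Lemma logjetB i j : logjet i * logjet j - logjet j * logjet i =
  (j%:R - i%:R : k)%:U * logjet (i + j).
Proof.
rewrite !logjetM -[_%:U]/(mx_ucst T n.+1 _) -[RHS]/(_ *m _) mul_scalar_mx.
apply/matrixP => a b; rewrite !mxE (addnC j i); case: eqP => _; last by rewrite !mulr0n mulr0 subrr.
rewrite !mulr1n rmorphB !rmorph_nat mulrBl -!natrM; apply/eqP.
rewrite subr_eq addrAC eq_sym subr_eq -!natrD; apply/eqP; congr (_%:R).
rewrite /logjet_coef; case: (nat_of_ord b) => [|b'] /=; nia.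
Qed.

(** The entries of [logjet i] are integers, hence central. *)
Lemma logjetC i (x : T) : x%:M * logjet i = logjet i * x%:M.
Proof.
rewrite -[LHS]/(_ *m _) mul_scalar_mx; apply/matrixP=> a b.
rewrite !mxE (bigD1 b) //= !mxE eqxx mulr1n big1 ?addr0 => [|l lb].
  by rewrite mulr_natr mulr_natl.
by rewrite !mxE (negPf lb) mulr0n mulr0.
Qed.

(** The tensor product of [T_n] with the representation [logjet]. *)
Lemma logjet_hom : exists f : T -> 'M[T]_n.+1,
  [/\ alg_hom f, forall a, f (tens a 1) = (tens a 1)%:M &
      forall i, f (v i) = (v i)%:M + logjet i].
Proof.
apply: Talg_lift => [|i ni|i j _ _|i a _].
- have [tB [t1 tM] tC] := alg_hom_tensl (weyl k) (env (gLie k n)).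
  split=> [a b||b]; first by rewrite tB raddfB.
    by split=> [|a b]; rewrite ?t1 // tM scalar_mxM.
  by rewrite tC.
- by rewrite Talg_v0 // logjet_eq0 // raddf0 addr0.
- have sM (x y : T) : (x * y)%:M = x%:M * y%:M :> 'M_n.+1 by exact: scalar_mxM.
  rewrite [RHS]mulrDr -logjetB -[_%:U]/(mx_ucst T n.+1 _) /mx_ucst -sM -Talg_v_comm raddfB /= !sM.
  exact: commutatorD (logjetC j (v i)) (logjetC i (v j)).
- have sM (x y : T) : (x * y)%:M = x%:M * y%:M :> 'M_n.+1 by exact: scalar_mxM.
  by rewrite mulrDl mulrDr logjetC -!sM Talg_wv.
Qed.

(** The filtration of [T_n] by the number of factors from [g_n]. *)
Inductive vfilt : nat -> T -> Prop :=
| vfilt_cst d (c : k) : vfilt d c%:U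
| vfiltD d x y : vfilt d x -> vfilt d y -> vfilt d (x + y)
| vfilt_weyl d a x : vfilt d x -> vfilt d (tens a 1 * x)
| vfilt_v d i x : vfilt d x -> vfilt d.+1 (v i * x).

Definition vfilt_pred (d : nat) (x : T) : Prop :=
  if d is d'.+1 then vfilt d' x else x = 0.

Lemma vfilt0 d : vfilt d 0.
Proof. by rewrite -(rmorph0 (@ucst k T)); apply: vfilt_cst. Qed.

Lemma vfiltMn d x j : vfilt d x -> vfilt d (x *+ j).
Proof.
by move=> dx; elim: j => [|j IH]; rewrite ?mulr0n ?mulrS; [apply: vfilt0 | apply: vfiltD].
Qed.

Lemma vfilt_sum d I (r : seq I) (F : I -> T) :
  (forall i, vfilt d (F i)) -> vfilt d (\sum_(i <- r) F i).
Proof. by move=> dF; apply: big_ind => //; [apply: vfilt0 | apply: vfiltD]. Qed.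

Lemma vfilt_le d e x : vfilt d x -> (d <= e)%N -> vfilt e x.
Proof.
move=> dx; elim: dx e => [{}d c|{}d {}x y _ IHx _ IHy|{}d a {}x _ IH|{}d i {}x _ IH] e de.
- exact: vfilt_cst.
- by apply: vfiltD; [apply: IHx | apply: IHy].
- exact/vfilt_weyl/IH.
- by case: e de => // e de; apply/vfilt_v/IH.
Qed.

Lemma vfilt_predW d x : vfilt_pred d x -> vfilt d x.
Proof. by case: d => [->|d /vfilt_le]; [apply: vfilt0 | apply]. Qed.

Lemma vfilt_exhaustive (x : T) : exists d, vfilt d x.
Proof.
suff: forall d y, vfilt d y -> exists e, vfilt e (x * y).
  by move=> /(_ 0%N 1); rewrite mulr1; apply; rewrite -(rmorph1 (@ucst k T)); apply: vfilt_cst.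
have HL := alg_hom_tensl (weyl k) (env (gLie k n)).
elim/Talg_ind: x => [||i _|c|x z IHx IHz|x z IHx IHz] d y dy.
- by exists d; apply: vfilt_weyl.
- by exists d; apply: vfilt_weyl.
- by exists d.+1; apply: vfilt_v.
- by exists d; rewrite -(alg_homU HL); apply: vfilt_weyl.
- have [[e ex] [e' ez]] := (IHx _ _ dy, IHz _ _ dy).
  exists (maxn e e'); rewrite mulrDl; apply: vfiltD.
    exact: vfilt_le ex (leq_maxl _ _).
  exact: vfilt_le ez (leq_maxr _ _).
- by have [e /IHx] := IHz _ _ dy; rewrite mulrA.
Qed.

Section LogjetDerivative.
Context (f : T -> 'M[T]_n.+1) (Hf : alg_hom f).
Hypothesis fw : forall a, f (tens a 1) = (tens a 1)%:M.
Hypothesis fv : forall i, f (v i) = (v i)%:M + logjet i.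

(** In the entries of [f x - x] at least one factor [v_i] is replaced by an integer, which
    lowers the filtration; this makes [dlast] below locally nilpotent. *)
Lemma logjet_hom_vfilt d x : vfilt d x ->
  forall a b, vfilt_pred d (f x a b - x *+ (a == b)).
Proof.
have E0 e : vfilt_pred e 0 by case: e => //= e; apply: vfilt0.
elim=> [{}d c|{}d {}x y _ IHx _ IHy|{}d w {}x _ IH|{}d i {}x dx IH] a b.
- by rewrite (alg_homU Hf) !mxE subrr.
- rewrite (alg_homD Hf) !mxE mulrnDl opprD addrACA.
  have := IHx a b; have := IHy a b; case: d {IHx IHy} => [/= -> ->|d Iy Ix]; first by rewrite addr0.
  exact: vfiltD.
- rewrite (alg_homM Hf) fw -[_ * _]/(_ *m _) mul_scalar_mx !mxE -mulrnAr -mulrBr.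
  by have := IH a b; case: d {IH} => [/= ->|d]; rewrite ?mulr0 //; apply: vfilt_weyl.
rewrite (alg_homM Hf) fv mulrDl -[_ * _]/(_ *m _) mul_scalar_mx mxE [_ a b]mxE.
rewrite -mulrnAr addrAC -mulrBr; apply: vfiltD.
  have := IH a b; case: (d) => [/= ->|d' dx']; last exact: vfilt_v.
  by rewrite mulr0; apply: vfilt0.
rewrite mxE; apply: vfilt_sum => l; rewrite mxE mulr_natl; apply: vfiltMn.
rewrite -[f x l b](subrK (x *+ (l == b))); apply: vfiltD; last exact: vfiltMn.
exact/vfilt_predW/IH.
Qed.

(** In the representation [logjet] the images of all vectors lie in the span of the [t^j],
    which is a complement of [w_0]. *)
Lemma logjet_row0 x b : f x ord0 b = x *+ (ord0 == b).
Proof.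
elim/Talg_ind: x b => [||i _|c|x y IHx IHy|x y IHx IHy] b.
- by rewrite fw mxE.
- by rewrite fw mxE.
- rewrite fv !mxE [X in _ + X](_ : _ = 0) ?addr0 //.
  by have := leq_maxl 1 b; case: eqP => //= e; lia.
- by rewrite (alg_homU Hf) mxE.
- by rewrite (alg_homD Hf) mxE IHx IHy mulrnDl.
- rewrite (alg_homM Hf) mxE (bigD1 ord0) //= IHx IHy eqxx mulr1n mulrnAr.
  by rewrite big1 ?addr0 // => l; rewrite IHx eq_sym => /negPf ->; rewrite mul0r.
Qed.

(** The entry of [f x] from [w_0] to [t^(n-1)] plays the role of [n ∂/∂v_(n-1)]. *)
Definition dlast (x : T) : T := f x ord_max ord0.

Lemma dlastM x : dlast (v m * x) = v m * dlast x + x *+ n.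
Proof.
rewrite /dlast (alg_homM Hf) fv mulrDl -[_ * _]/(_ *m _) mul_scalar_mx mxE [_ _ ord0]mxE.
congr (_ + _); rewrite mxE (bigD1 ord0) //= mxE addn1 eqxx mulr1n mulr_natl.
rewrite logjet_row0 eqxx mulr1n big1 ?addr0 // => l; rewrite mxE => l0.
rewrite (_ : logjet_coef m l *+ _ = 0%N) ?mul0r //; case: l l0 => -[|l] //= _ _.
case: eqP => //; rewrite mulr1n; lia.
Qed.

Lemma iter_dlastM N x :
  iter N dlast (v m * x) = v m * iter N dlast x + iter N.-1 dlast x *+ (N * n).
Proof.
have dD y z : dlast (y + z) = dlast y + dlast z by rewrite /dlast (alg_homD Hf) mxE.
have dMn y j : dlast (y *+ j) = dlast y *+ j.
  elim: j => [|j IH]; last by rewrite !mulrS dD IH.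
  by rewrite !mulr0n /dlast (alg_hom0 Hf) mxE.
elim: N => [|N IH]; first by rewrite mul0n mulr0n addr0.
rewrite iterS IH dD dlastM dMn -addrA -iterS mulSn mulrnDr; congr (_ + (_ + _)).
by case: N {IH} => //; rewrite mul0n !mulr0n.
Qed.

Lemma dlast_nilpotent x : exists N, iter N dlast x = 0.
Proof.
have [d dx] := vfilt_exhaustive x; exists d.+1; elim: d x dx => [|d IH] x dx.
  by have := logjet_hom_vfilt dx ord_max ord0; rewrite /= subr0.
rewrite iterSr; apply: IH.
by have := logjet_hom_vfilt dx ord_max ord0; rewrite /= subr0.
Qed.

End LogjetDerivative.

Lemma ucst_natK (A : ualgType k) (j : nat) (x : A) :
  [pchar k] =i pred0 -> x *+ j.+1 = 0 -> x = 0.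
Proof.
move=> k0 xj; rewrite -[x]mul1r -(rmorph1 (@ucst k A)) -(@mulVf _ j.+1%:R).
  by rewrite rmorphM rmorph_nat -mulrA mulr_natl xj mulr0.
by rewrite (pcharf0P _).1.
Qed.

(** If [v_(n-1) x = 0] and [D^(N+1) x = 0], then applying [D^(N+1)] to [v_(n-1) x] leaves
    [(N+1) n D^N x = 0]; descend on [N]. *)
Lemma Talg_v_last_regular (x : T) :
  [pchar k] =i pred0 -> v m * x = 0 -> x = 0.
Proof.
move=> k0 vx; have [f [Hf fw fv]] := logjet_hom.
have [N] := dlast_nilpotent Hf fw fv x; elim: N => // N IH ND; apply: IH.
have := iter_dlastM Hf fw fv N.+1 x; rewrite vx ND mulr0 add0r.
have -> : iter N.+1 (dlast f) 0 = 0.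
  by elim: N.+1 => // j /= ->; rewrite /dlast (alg_hom0 Hf) mxE.
by move/esym; rewrite mulnS addSn; apply: ucst_natK.
Qed.

End LastGeneratorRegular.

(** * The first-order shift *)

Section TriangularMatrices.
Context (k : fieldType) (A : ualgType k).

Definition tri (a b d : A) : 'M[A]_2 :=
  \matrix_(i, j) if i == ord0 then if j == ord0 then a else b
                 else if j == ord0 then 0 else d.

Lemma triM a b d a' b' d' : tri a b d * tri a' b' d' =
  tri (a * a') (a * b' + b * d') (d * d').
Proof.
apply/matrixP => i j; rewrite !mxE !big_ord_recl big_ord0 addr0 !mxE /=.
by case: (i == ord0); case: (j == ord0); rewrite ?(mulr0, mul0r, addr0, add0r).
Qed.

Lemma triD a b d a' b' d' : tri a b d + tri a' b' d' = tri (a + a') (b + b') (d + d').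
Proof.
by apply/matrixP => i j; rewrite !mxE; case: eqP; case: eqP; rewrite // addr0.
Qed.

Lemma triB a b d a' b' d' : tri a b d - tri a' b' d' = tri (a - a') (b - b') (d - d').
Proof.
by apply/matrixP => i j; rewrite !mxE; case: eqP; case: eqP; rewrite // subr0.
Qed.

Lemma tri_cst (c : k) : c%:U = tri c%:U 0 c%:U.
Proof.
rewrite -[LHS]/(mx_ucst A 2 c); apply/matrixP => i j; rewrite !mxE.
by case: i j => [[|[|]]] // ? [[|[|]]].
Qed.

Lemma tri_sum I (r : seq I) (a b d : I -> A) :
  \sum_(i <- r) tri (a i) (b i) (d i) =
  tri (\sum_(i <- r) a i) (\sum_(i <- r) b i) (\sum_(i <- r) d i).
Proof.
elim: r => [|i r IH]; last by rewrite !big_cons IH triD.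
by rewrite !big_nil; apply/matrixP => i j; rewrite !mxE !if_same.
Qed.

End TriangularMatrices.

Section FirstOrderShift.
Context (k : fieldType).

(** Setting [v_(-1) = ∂] makes [Psi_n f] the sum of the [f^(p) / p! * v_(p-1)] over
    [0 <= p <= n]. *)
Definition orbit_gen n (p : nat) : Talg k n :=
  if p is q.+1 then Talg_v k n q else tens (wd k) 1.

Definition cpoly n (f : {poly k}) : Talg k n := tens (wpoly f) 1.

Lemma cpolyB n f g : cpoly n (f - g) = cpoly n f - cpoly n g.
Proof. by rewrite /cpoly raddfB tensBl. Qed.

Lemma cpolyMn n f j : cpoly n (f *+ j) = cpoly n f *+ j.
Proof.
have P0 : cpoly n 0 = 0 by rewrite -(subrr 0) cpolyB subrr.
elim: j => [|j IH]; first by rewrite !mulr0n.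
by rewrite !mulrS -IH /cpoly raddfD tensDl.
Qed.

Lemma cpolyM n f g : cpoly n (f * g) = cpoly n f * cpoly n g.
Proof. by rewrite /cpoly wpolyM tensM mulr1. Qed.

Lemma Psi_gen_sum n f :
  Psi_gen n f = \sum_(p < n.+1) cpoly n f^`N(p) * orbit_gen n p.
Proof.
rewrite big_ord_recl /= nderivn0 [_ * orbit_gen n 0]tensM mulr1; congr (_ + _).
by apply: eq_bigr => i _; rewrite [RHS]tensM mulr1 mul1r.
Qed.

Lemma orbit_gen0 n p : (n < p)%N -> orbit_gen n p = 0.
Proof. by case: p => // p np; apply: Talg_v0. Qed.

Lemma wd_comm_wpoly (f : {poly k}) : wd k * wpoly f - wpoly f * wd k = wpoly f^`().
Proof. by rewrite wd_wpoly addrC addKr. Qed.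

Variable n : nat.
Local Notation T := (Talg k n).
Local Notation v := (Talg_v k n).
Local Notation w a := (tens (a : weyl k) (1 : env (gLie k n))).
Local Notation U := (orbit_gen n).

Lemma Talg_mulrn (j : nat) (x : T) : x *+ j = (j%:R : k)%:U * x.
Proof. by rewrite rmorph_nat mulr_natl. Qed.

Lemma shift_relD i j :
  (v i + (i == 0%N)%:R) * (v j + (j == 0%N)%:R)
    - (v j + (j == 0%N)%:R) * (v i + (i == 0%N)%:R) =
  (j%:R - i%:R : k)%:U * (v (i + j)%N + (i + j == 0)%N%:R).
Proof.
have bC (x : T) (l : nat) : x * l%:R = l%:R * x by rewrite mulr_natr mulr_natl.
rewrite commutatorD // Talg_v_comm mulrDr; congr (_ + _).
by case: i j => [|i] [|j]; rewrite ?mulr0 ?mul0r ?subrr ?rmorph0 ?mul0r.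
Qed.

(** The off-diagonal part of [[v_i + (i+1) ε v_(i-1), v_j + (j+1) ε v_(j-1)]], by the
    identity [(j+1) (j-1-i) + (i+1) (j+1-i) = (j-i) (i+j+1)]. *)
Lemma shift_relU i j :
  (v i + (i == 0%N)%:R) * (U j *+ j.+1) + U i *+ i.+1 * v j
    - ((v j + (j == 0%N)%:R) * (U i *+ i.+1) + U j *+ j.+1 * v i) =
  (j%:R - i%:R : k)%:U * (U (i + j)%N *+ (i + j).+1).
Proof.
have wv (a : weyl k) l : tens a 1 * v l = v l * tens a 1 by exact: Talg_wv.
have br a b s : v a * (v b *+ s) - v b *+ s * v a =
    (s%:R * (b%:R - a%:R) : k)%:U * v (a + b)%N.
  by rewrite mulrnAr [_ * v a]mulrnAl -mulrnBl Talg_v_comm Talg_mulrn rmorphM mulrA.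
pose L i j := (v i + (i == 0%N)%:R) * (U j *+ j.+1) + U i *+ i.+1 * v j.
pose R i j := (j%:R - i%:R : k)%:U * (U (i + j)%N *+ (i + j).+1).
rewrite -/(L i j) -/(L j i) -/(R i j).
have L0 q : L 0%N q.+1 - L q.+1 0%N = R 0%N q.+1.
  rewrite /L /R /= addr0 add0n mulr1n wv mulrDl mul1r opprD.
  rewrite addrA addrK addrAC br !Talg_mulrn mulrA -rmorphM -mulrDl -rmorphD.
  congr (_%:U * _); ring.
have LS p q : L p.+1 q.+1 - L q.+1 p.+1 = R p.+1 q.+1.
  rewrite /L /R /= !addr0 opprD [- _ - _]addrC addrACA br -[X in _ + X]opprB br.
  rewrite addSn addnS (addSn q) (addnC q) Talg_mulrn mulrA -rmorphM -mulrBl -rmorphB.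
  congr (_%:U * _); ring.
have RC a b : R a b = - R b a by rewrite /R addnC -mulNr -rmorphN opprB.
case: i j => [|i] [|j]; rewrite ?L0 ?LS //; first by rewrite subrr /R subrr rmorph0 mul0r.
by rewrite RC -L0 opprB.
Qed.

(** The homomorphism [ρ] from [T_(n+1)] to [T_n[ε]].  Here [ε] is the matrix unit of the
    upper right corner, [x] in [T_n] is the diagonal matrix with entries [x] and, in the upper
    left corner, [x] with [v_0] replaced by [v_0 + 1], and [ad ∂] is the derivation [d/dt]
    of the Weyl algebra. *)
Definition first_order_shift (f : Talg k n.+1 -> 'M[T]_2) : Prop :=
  [/\ alg_hom f,
      forall a, f (tens a 1) = tri (w a) (- w (wd k * a - a * wd k)) (w a) &
      forall i, f (Talg_v k n.+1 i) =
        tri (v i + (i == 0%N)%:R) (U i *+ i.+1) (v i)].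

Lemma shift_hom : exists f, first_order_shift f.
Proof.
have HL : alg_hom (fun a : weyl k => w a) by exact: alg_hom_tensl.
have wv a i : w a * v i = v i * w a by exact: Talg_wv.
apply: Talg_lift => [|i ni|i j _ _|i a _].
- split=> [a b||c].
  + rewrite triB -opprD -!(alg_homB HL); congr (tri _ (- w _) _).
    by rewrite mulrBr mulrBl opprD addrACA -opprD.
  + split=> [|a b]; first by rewrite mulr1 mul1r subrr (alg_hom0 HL) oppr0 (alg_hom1 HL) -(rmorph1 (@ucst k _)) -tri_cst rmorph1.
    rewrite triM -!(alg_homM HL); congr (tri _ _ _).
    rewrite mulrN mulNr -opprD -!(alg_homM HL) -(alg_homD HL); congr (- w _).
    by rewrite mulrBl mulrBr !mulrA [RHS]addrC subrKA.
  + by rewrite ucstC subrr (alg_hom0 HL) oppr0 (alg_homU HL) -tri_cst.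
- rewrite orbit_gen0 // mul0rn Talg_v0 ?(ltnW ni) // add0r.
  have -> : (i == 0%N) = false by case: i ni.
  by apply/matrixP => a b; rewrite !mxE !if_same.
- by rewrite !triM triB tri_cst triM mul0r !addr0 shift_relD shift_relU Talg_v_comm.
- rewrite !triM -!wv !(mulrDl, mulrDr) -!wv.
  have bC (x : T) : (i == 0%N)%:R * x = x * (i == 0%N)%:R by rewrite mulr_natr mulr_natl.
  congr (tri _ _ _); first by rewrite bC.
  rewrite mulNr mulrN wv addrC -addrA; congr (_ + _).
  case: i {bC} => [|i]; last by rewrite /= mul0r add0r mulrnAr mulrnAl wv.
  by rewrite /= mul1r !mulr1n -!(alg_homM HL) (alg_homB HL) opprB subrK.
Qed.

End FirstOrderShift.

Section KernelInclusion.
Context (k : fieldType) (m : nat).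
Local Notation n := m.+1.
Local Notation T := (Talg k n).
Local Notation v := (Talg_v k n).

(** The inclusion of [T_n] into [T_n[ε]]. *)
Definition unshifted (g : T -> 'M[T]_2) : Prop :=
  [/\ alg_hom g,
      forall a, g (tens a 1) = tri (tens a 1) 0 (tens a 1) &
      forall i, g (v i) = tri (v i + (i == 0%N)%:R) 0 (v i)].

Lemma base_hom : exists g, unshifted g.
Proof.
have HL : alg_hom (fun a : weyl k => tens a 1 : T) by exact: alg_hom_tensl.
apply: Talg_lift => [|i ni|i j _ _|i a _].
- split=> [a b||c].
  + by rewrite triB subrr -!(alg_homB HL).
  + split=> [|a b]; last by rewrite triM mulr0 mul0r addr0 -!(alg_homM HL).
    by rewrite (alg_hom1 HL) -(rmorph1 (@ucst k _)) -tri_cst rmorph1.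
  + by rewrite (alg_homU HL) -tri_cst.
- rewrite Talg_v0 // add0r; case: i ni => // i _.
  by apply/matrixP => a b; rewrite !mxE !if_same.
- by rewrite !triM triB tri_cst triM !mulr0 !mul0r !addr0 subrr shift_relD Talg_v_comm.
- rewrite !triM !mulr0 !mul0r !addr0 mulrDr mulrDl Talg_wv.
  by rewrite mulr_natr mulr_natl.
Qed.

(** The off-diagonal entry of [ρ (Psi_(n+1) f)] telescopes: the shift of [t] turns
    [f^(p) / p!] into a multiple of [f^(p+1) / (p+1)!], which cancels the shift of [v_p]. *)
Lemma shift_base_Psi (f : Talg k n.+1 -> 'M[T]_2) (g : T -> 'M[T]_2) :
  first_order_shift f -> unshifted g ->
  forall u, f (Psi k n.+1 u) = g (Psi k n u).
Proof.
move=> [Hf fw fv] [Hg gw gv].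
have HL : alg_hom (fun a : weyl k => tens a 1 : T) by exact: alg_hom_tensl.
have comp_hom (h : ualgType k) N (e : Talg k N -> h) :
    alg_hom e -> alg_hom (fun u => e (Psi k N u)).
  move=> He; have HP := Psi_hom k N; split=> [a b||c].
  - by rewrite (alg_homB HP) (alg_homB He).
  - by split=> [|a b]; rewrite ?(alg_hom1 HP) ?(alg_hom1 He) ?(alg_homM HP) ?(alg_homM He).
  - by rewrite (alg_homU HP) (alg_homU He).
apply: (alg_hom_ext (comp_hom _ _ _ Hf) (comp_hom _ _ _ Hg)) => p.
rewrite -[pgen p]/(env_in p) !PsiE !Psi_gen_sum (alg_hom_sum Hf) (alg_hom_sum Hg).
pose U := orbit_gen k n; pose P := @cpoly k n.
have fU q : f (orbit_gen k n.+1 q) = tri (U q + (q == 1%N)%:R) (U q.-1 *+ q) (U q).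
  case: q => [|q]; last exact: fv.
  by rewrite mulr0n addr0 fw subrr (alg_hom0 HL) oppr0.
have gU q : g (U q) = tri (U q + (q == 1%N)%:R) 0 (U q).
  by case: q => [|q]; [rewrite gw addr0 | exact: gv].
have fP q : f (cpoly n.+1 q) = tri (P q) (- P q^`()) (P q).
  by rewrite fw wd_comm_wpoly.
have gP q : g (P q) = tri (P q) 0 (P q) by exact: gw.
transitivity (\sum_(q < n.+2) g (P p^`N(q) * U q)); last first.
  by rewrite big_ord_recr /= Talg_v0 // mulr0 (alg_hom0 Hg) addr0.
under eq_bigr => q _ do rewrite (alg_homM Hf) fP fU triM.
under [RHS]eq_bigr => q _ do rewrite (alg_homM Hg) gP gU triM mulr0 mul0r addr0.
rewrite !tri_sum big1_eq; congr (tri _ _ _).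
pose G q := (P p^`N(q) * U q.-1) *+ q.
transitivity (\sum_(0 <= q < n.+2) - (G q.+1 - G q)).
  rewrite big_mkord; apply: eq_bigr => q _.
  rewrite opprB mulrnAr mulNr; congr (_ - _).
  by rewrite deriv_nderivn /G /= -mulrnAl /P cpolyMn.
rewrite sumrN telescope_sumr // /G /= Talg_v0 // mulr0 mul0rn mulr0n.
by rewrite subrr oppr0.
Qed.

(** Modulo [ε] the homomorphism [ρ] is the projection to [T_n]. *)
Lemma shift_lower (f : Talg k n.+1 -> 'M[T]_2) : first_order_shift f ->
  forall x, f x ord_max ord0 = 0 /\ f x ord_max ord_max = Talg_proj k n x.
Proof.
move=> [Hf fw fv].
have Hp := Talg_proj_hom k n.
have e1 : env_map (gLie_proj_hom k n) 1 = 1.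
  exact: (alg_hom1 (env_map_hom (gLie_proj_hom k n))).
elim/Talg_ind => [||i _|c|x y [x0 x1] [y0 y1]|x y [x0 x1] [y0 y1]].
- by rewrite fw Talg_proj_tens e1 !mxE.
- by rewrite fw Talg_proj_tens e1 !mxE.
- by rewrite fv Talg_proj_v !mxE.
- by rewrite (alg_homU Hf) (alg_homU Hp) tri_cst !mxE.
- by rewrite (alg_homD Hf) (alg_homD Hp) !mxE x0 x1 y0 y1 addr0.
- rewrite (alg_homM Hf) (alg_homM Hp) !mxE !big_ord_recl !big_ord0 !addr0.
  have -> : lift ord0 ord0 = ord_max :> 'I_2 by apply: val_inj.
  by rewrite x0 x1 y0 y1 !mul0r mulr0 !add0r.
Qed.

Lemma Psi_kernel_sub (k0 : [pchar k] =i pred0) u : Psi k n u = 0 ->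
  exists x, Psi k n.+1 u = x * Talg_v k n.+1 n ^+ 2.
Proof.
move=> Pu; have [f Sf] := shift_hom k n; have [g Sg] := base_hom.
have fP := shift_base_Psi Sf Sg u.
have [y Ey] : exists y, Psi k n.+1 u = Talg_v k n.+1 n * y.
  by apply: Talg_proj_eq0; rewrite Talg_proj_Psi.
have [_ fy] := shift_lower Sf y.
have [[Hf _ fv] [Hg _ _]] := (Sf, Sg).
have [z Ez] : exists z, y = Talg_v k n.+1 n * z.
  apply: Talg_proj_eq0; apply: (Talg_v_last_regular k0); apply: (ucst_natK (j := n) k0).
  (* the entry at [ε] of [ρ (v_n y)] is [(n+1) v_(n-1)] times the image of [y] *)
  move: fP; rewrite Pu (alg_hom0 Hg) Ey (alg_homM Hf) fv Talg_v0 // add0r.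
  move/matrixP/(_ ord0 ord_max); rewrite !mxE !big_ord_recl big_ord0 !mxE /= mul0r add0r addr0.
  have -> : lift ord0 ord0 = ord_max :> 'I_2 by apply: val_inj.
  by rewrite fy mulrnAl.
have [_ [x1 E1]] := top_normal z; have [_ [x2 E2]] := top_normal x1.
by exists x2; rewrite Ey Ez E1 mulrA E2 expr2 mulrA.
Qed.

End KernelInclusion.

(** * The left ideal generated by the square of the last generator *)

Section Differentiators.
Context (k : fieldType).

Definition hasse (f g : {poly k}) (p q : nat) : {poly k} := f^`N(p) * g^`N(q).

(** The effect on the array of the [f^[p] g^[q]] of replacing [f ⊗ g] by
    [t f ⊗ g - f ⊗ t g]. *)
Definition dshift (h : nat -> nat -> {poly k}) (p q : nat) : {poly k} :=
  (if p is p'.+1 then h p' q else 0) - (if q is q'.+1 then h p q' else 0).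

Lemma dshiftE h p q : dshift h p q =
  (if p is p'.+1 then h p' q else 0) - (if q is q'.+1 then h p q' else 0).
Proof. by []. Qed.

Lemma nderivnXM (f : {poly k}) p :
  ('X * f)^`N(p) = 'X * f^`N(p) + (if p is p'.+1 then f^`N(p') else 0).
Proof.
have X1 j : ('X)^`N(j.+1) = (j == 0%N)%:R :> {poly k}.
  rewrite -['X]expr1 nderivnXn; case: j => [|j]; first by rewrite subnn binn.
  by rewrite bin_small ?mulr0n.
case: p => [|p]; first by rewrite !nderivn0 addr0.
rewrite nderivnM !big_ord_recl nderivn0 subn0 X1 mul1r subSS subn0 big1 ?addr0 // => i _.
by rewrite X1 mul0r.
Qed.

(** The divided derivatives satisfy [(t f)^[p] = t f^[p] + f^[p-1]], and the terms
    with the factor [t] cancel. *)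
Lemma hasse_shift f g p q :
  hasse ('X * f) g p q - hasse f ('X * g) p q = dshift (hasse f g) p q.
Proof.
rewrite /hasse /dshift !nderivnXM mulrDl mulrDr mulrCA mulrA opprD addrACA subrr add0r.
by case: p q => [|p] [|q]; rewrite ?mul0r ?mulr0.
Qed.

Lemma dshift_iter_sub d h h' p q :
  iter d dshift (fun p q => h p q - h' p q) p q = iter d dshift h p q - iter d dshift h' p q.
Proof.
elim: d p q => // d IH p q; rewrite !iterS !dshiftE.
by case: p q => [|p] [|q]; rewrite ?IH ?subrr //; ring.
Qed.

Lemma dshift_iter_low d h p q : (p + q < d)%N -> iter d dshift h p q = 0.
Proof.
elim: d p q => // d IH p q pq; rewrite iterS dshiftE.
by case: p q pq => [|p] [|q] pq; rewrite ?IH ?subrr //; lia.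
Qed.

Lemma dshift_iter_diag d h p q : (p + q = d)%N ->
  iter d dshift h p q = (-1) ^+ q * h 0 0 *+ 'C(d, p).
Proof.
elim: d p q => [|d IH] p q; first by case: p q => [|p] [|q] //= _; rewrite mul1r.
rewrite iterS dshiftE; case: p q => [|p] [|q] // pq.
- by rewrite IH; [rewrite !bin0 !mulr1n exprS mulN1r mulNr sub0r | lia].
- by rewrite IH; [rewrite subr0 (_ : d = p) ?binn //; lia | lia].
rewrite !IH ?binS ?mulrnDr; try lia.
by rewrite [RHS]addrC; congr (_ + _); rewrite exprS mulN1r mulNr mulNrn.
Qed.

End Differentiators.

Section PrincipalLeftIdeal.
Context (k : fieldType) (n : nat).
Local Notation T := (Talg k n).
Local Notation U := (orbit_gen k n).
Local Notation P := (@cpoly k n).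

(** [Psi f * Psi g] as a function of the array of the [f^[p] g^[q]].  The second sum comes
    from moving [∂] past the coefficients of [Psi g]. *)
Definition orbit_pair (h : nat -> nat -> {poly k}) : T :=
  \sum_(p < n.+1) \sum_(q < n.+1) P (h p q) * U p * U q
  + \sum_(q < n.+1) P (h 0%N q.+1) *+ q.+1 * U q.

Lemma orbit_gen_cpoly p f : U p * P f = P f * U p + (if p is 0 then P f^`() else 0).
Proof.
case: p => [|p]; last by rewrite addr0 [RHS]Talg_wv.
rewrite /cpoly /= !tensM !mulr1 wd_wpoly tensDl.
by [].
Qed.

Lemma Psi_gen_mul f g : Psi_gen n f * Psi_gen n g = orbit_pair (hasse f g).
Proof.
rewrite !Psi_gen_sum mulr_suml /orbit_pair.
transitivity (\sum_(p < n.+1) \sum_(q < n.+1) (P (hasse f g p q) * U p * U q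
   + (if p == ord0 then P f * P (g^`N(q)^`()) * U q else 0))).
  apply: eq_bigr => p _; rewrite mulr_sumr; apply: eq_bigr => q _.
  rewrite mulrA -(mulrA (P _)) orbit_gen_cpoly mulrDr mulrDl /hasse cpolyM.
  rewrite !mulrA; congr (_ + _); case: p => [[|p] lp] //=.
    by rewrite nderivn0.
  by rewrite mulr0 mul0r.
under eq_bigr => p _ do rewrite big_split /=.
rewrite big_split /=; congr (_ + _); rewrite (bigD1 ord0) //= [X in _ + X]big1 ?addr0; last first.
  by move=> p /negPf ->; rewrite big1.
apply: eq_bigr => q _; rewrite -cpolyM deriv_nderivn mulrnAr cpolyMn.
by rewrite /hasse nderivn0.
Qed.

Lemma Balg_gen f : Balg k n (Psi_gen n f).
Proof. by exists (env_in (f : witt k)); rewrite ?PsiE. Qed.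
Lemma BalgD x y : Balg k n x -> Balg k n y -> Balg k n (x + y).
Proof.
by move=> [u _ <-] [u' _ <-]; exists (u + u'); rewrite ?(alg_homD (Psi_hom k n)).
Qed.
Lemma BalgB x y : Balg k n x -> Balg k n y -> Balg k n (x - y).
Proof.
by move=> [u _ <-] [u' _ <-]; exists (u - u'); rewrite ?(alg_homB (Psi_hom k n)).
Qed.
Lemma BalgM x y : Balg k n x -> Balg k n y -> Balg k n (x * y).
Proof.
by move=> [u _ <-] [u' _ <-]; exists (u * u'); rewrite ?(alg_homM (Psi_hom k n)).
Qed.
Lemma BalgU (c : k) : Balg k n c%:U.
Proof. by exists c%:U; rewrite ?(alg_homU (Psi_hom k n)). Qed.

Lemma orbit_pairB h h' :
  orbit_pair (fun p q => h p q - h' p q) = orbit_pair h - orbit_pair h'.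
Proof.
rewrite /orbit_pair opprD addrACA -!sumrB; congr (_ + _).
  by apply: eq_bigr => p _; rewrite -sumrB; apply: eq_bigr => q _; rewrite cpolyB !mulrBl.
by apply: eq_bigr => q _; rewrite cpolyB mulrnBl mulrBl.
Qed.

Lemma eq_orbit_pair h h' : (forall p q, h p q = h' p q) -> orbit_pair h = orbit_pair h'.
Proof.
by move=> E; rewrite /orbit_pair; congr (_ + _); apply: eq_bigr => p _;
  [apply: eq_bigr => q _|]; rewrite E.
Qed.

(** The alternating sums of the [Psi (t^(d-i) f) * Psi (t^i g)] with binomial coefficients,
    written as iterated differences. *)
Lemma Balg_differentiator d f g : Balg k n (orbit_pair (iter d (@dshift k) (hasse f g))).
Proof.
elim: d f g => [|d IH] f g; first by rewrite -Psi_gen_mul; apply: BalgM; apply: Balg_gen.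
rewrite iterSr (_ : dshift _ = fun p q => hasse ('X * f) g p q - hasse f ('X * g) p q).
  by rewrite (eq_orbit_pair (dshift_iter_sub _ _ _)) orbit_pairB; apply: BalgB.
by apply/funext => p; apply/funext => q; rewrite hasse_shift.
Qed.

(** With [2n] steps the array vanishes at all [p + q < 2n].  As [p, q <= n], only
    [p = q = n] remains, and the correction terms have order at most [n + 1 < 2n]. *)
Lemma Balg_last_sqr (k0 : [pchar k] =i pred0) f : (1 < n)%N ->
  Balg k n (P f * Talg_v k n n.-1 ^+ 2).
Proof.
move=> n1; have P0 : P 0 = 0 by rewrite -(subrr 0) cpolyB subrr.
have := Balg_differentiator (n + n) f 1.
rewrite /orbit_pair addrC big1 ?add0r => [|q _]; last first.
  rewrite dshift_iter_low; first by rewrite P0 mul0rn mul0r.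
  by have := ltn_ord q; lia.
rewrite big_ord_recr /= big1 ?add0r => [|p _]; last first.
  apply: big1 => q _; rewrite dshift_iter_low ?P0 ?mul0r //.
  by have := ltn_ord q; have := ltn_ord p; lia.
rewrite big_ord_recr /= big1 ?add0r => [|q _]; last first.
  rewrite dshift_iter_low ?P0 ?mul0r //.
  by have := ltn_ord q; lia.
rewrite dshift_iter_diag // /hasse !nderivn0 mulr1.
set C := 'C(_, _).
have C0 : (C%:R : k) != 0 by rewrite (pcharf0P _).1 // -lt0n bin_gt0 leq_addr.
set e := (-1) ^+ n.
have eE : e = ((-1) ^+ n : k)%:P by rewrite /e rmorphXn rmorphN1.
move=> BC; pose s : k := (-1) ^+ n * C%:R^-1.
have -> : P f * Talg_v k n n.-1 ^+ 2 = s%:U * (P (e * f *+ C) * U n * U n).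
  rewrite -mulrA -[U n * U n]/(U n ^+ 2) (_ : U n = Talg_v k n n.-1); last first.
    by case: (n) n1.
  rewrite [RHS]mulrA; congr (_ * _ ^+ 2); rewrite /cpoly -tensZl -wpolyZ; congr tens; congr wpoly.
  rewrite eE mul_polyC -scaler_nat !scalerA /s.
  by rewrite divfK // -expr2 sqrr_sign scale1r.
by apply: BalgM BC; apply: BalgU.
Qed.

(** The largest [k[t]]-submodule of [B_n], on which [T_n] acts by left multiplication. *)
Definition multipliers (s : T) := forall f, Balg k n (P f * s).

(** In [Psi (t^(i+1))] the generator [v_i] has coefficient [1], only [v_j] with [j <= i]
    occur, and those with [j < i], as well as [∂], are known to preserve the multipliers. *)
Lemma multipliers_gen i s : multipliers s ->
  forall j, (j < i)%N -> multipliers (U j * s).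
Proof.
move=> Bs; elim: i => // i IH j; rewrite ltnS leq_eqVlt => /orP[/eqP->|]; last exact: IH.
case: i IH {j} => [_|i IH] f.
  rewrite mulrA -[P f * _](addrK (P f^`())) -[P f * U 0%N + _](orbit_gen_cpoly 0).
  rewrite mulrBl -mulrA; apply: BalgB (Bs _); apply: BalgM (Bs _).
  have -> : U 0%N = Psi_gen n (1 : {poly k}); last exact: Balg_gen.
  rewrite Psi_gen_sum big_ord_recl nderivn0 big1 ?addr0 => [|q _].
    by rewrite /cpoly -(expr0 'X) wpolyXn expr0 tens11 mul1r.
  by rewrite /= -(expr0 'X) nderivnXn bin0n mulr0n /cpoly raddf0 tens0l mul0r.
have B0 : Balg k n 0 by rewrite -(rmorph0 (@ucst k T)); apply: BalgU.
have [ni|ni] := ltnP n i.+1; first by rewrite orbit_gen0 // mul0r mulr0.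
have Ef p g : P g * U p * (P f * s) =
    P (g * f) * (U p * s) + (if p is 0 then P (g * f^`()) * s else 0).
  rewrite -mulrA (mulrA (U p)) orbit_gen_cpoly mulrDl mulrDr !cpolyM !mulrA.
  by case: p => [|p] //; rewrite mulr0 mul0r.
have := BalgM (Balg_gen 'X^(i.+1)) (Bs f).
rewrite Psi_gen_sum mulr_suml (bigD1 (Ordinal (ni : (i.+1 < n.+1)%N))) //.
rewrite [nat_of_ord (Ordinal _)]/= Ef nderivnXn subnn binn mul1r addr0 => BX.
(* [S] collects the terms of [Psi (t^(i+1)) * (f s)] other than that of [v_i] *)
set S := \sum_(_ < _ | _) _ in BX; have BS : Balg k n S.
  apply: (big_ind (Balg k n)) => // [x y|p]; first exact: BalgD.
  rewrite -val_eqE /= neq_ltn => /orP[pi|ip].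
    rewrite Ef; apply: BalgD; first exact: IH.
    by case: (nat_of_ord p) => [|p'] //; apply: Bs.
  by rewrite nderivnXn bin_small // mulr0n /cpoly raddf0 tens0l !mul0r.
by have := BalgB BX BS; rewrite addrK.
Qed.

Lemma multipliers_ideal s : multipliers s -> forall x, multipliers (x * s).
Proof.
move=> Bs x; elim/Talg_ind: x s Bs => [||i ni|c|x y IHx IHy|x y IHx IHy] s Bs f.
- rewrite mulrA [P f * _](_ : _ = P (f * 'X)); first exact: Bs.
  by rewrite cpolyM; congr (_ * _); rewrite /cpoly -['X]expr1 wpolyXn expr1.
- exact: (multipliers_gen Bs (ltn0Sn 0) f).
- exact: (multipliers_gen Bs (ltnSn i.+1) f).
- by rewrite mulrA -ucstC -mulrA; apply: BalgM (Bs f); apply: BalgU.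
- by rewrite mulrDl mulrDr; apply: BalgD; [apply: IHx | apply: IHy].
- by rewrite -mulrA; apply: (IHx _ _ f); apply: IHy.
Qed.

Lemma Balg_last_sqr_ideal (k0 : [pchar k] =i pred0) x : (1 < n)%N ->
  Balg k n (x * Talg_v k n n.-1 ^+ 2).
Proof.
move=> n1; rewrite -[x * _]mul1r -tens11 -(expr0 (wt k)) -wpolyXn.
by apply: multipliers_ideal => f; apply: Balg_last_sqr.
Qed.

End PrincipalLeftIdeal.

(** * The kernel of the natural surjection *)

Unset Implicit Arguments.
Local Open Scope classical_set_scope.

Theorem corollary4p21 (k : fieldType) (k_char0 : [pchar k] =i pred0)
    (n : nat) (n_ge1 : (1 <= n)%N) :
  Balg k n.+1 `&` Talg_proj k n @^-1` [set 0] =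
  [set x * Talg_v k n.+1 n ^+ 2 | x in [set: Talg k n.+1]].
Proof.
case: n n_ge1 => // m _; apply/seteqP; split=> [x [[u _ <-] /= Pu]|_ [x _ <-]].
  have [y ->] : exists y, Psi k m.+2 u = y * Talg_v k m.+2 m.+1 ^+ 2.
    by apply: Psi_kernel_sub => //; rewrite -Talg_proj_Psi.
  by exists y.
split; first exact: (Balg_last_sqr_ideal (n := m.+2)).
have Hp := Talg_proj_hom k m.+1.
by rewrite /= (alg_homM Hp) expr2 (alg_homM Hp) Talg_proj_v_last mulr0 mulr0.
Qed.
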